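(* Let $d\ge 1$, let $\alpha=(\alpha_1,\dots,\alpha_d)\in\mathbb{R}^d$, let $T_\alpha:\mathbb{T}^d\to\mathbb{T}^d$, $T_\alpha(x)=x+\alpha$, be the translation of vector $\alpha$ on $\mathbb{T}^d=\mathbb{R}^d/\mathbb{Z}^d$, and let $\mu$ be the Haar probability measure on $\mathbb{T}^d$. Then: (1) $(T_\alpha,\mathbb{T}^d,\mu)$ has the Monotone Shrinking Target Property (MSTP) if and only if $\alpha$ is of constant type. (2) For every $\alpha\in\mathbb{R}^d$, $(T_\alpha,\mathbb{T}^d,\mu)$ does not have the Shrinking Target Property (STP). (3) Moreover, if $\alpha$ is not a rational vector (i.e. $\alpha\notin\mathbb{Q}^d$), there exists a sequence $(r_n)_{n\in\mathbb{N}}$ of real numbers $r_n\ge 0$ with $\sum_{n} r_n^d=\infty$ such that for every $x_0\in\mathbb{T}^d$, $$\limsup_n T_\alpha^{-n}B(x_0,r_n)=\bigcap_{n_0\in\mathbb{N}}\bigcup_{n\ge n_0}T_\alpha^{-n}B(x_0,r_n)=\emptyset .$$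
   Context: For $\beta\in\mathbb{R}$ put $\|\beta\|=\inf_{p\in\mathbb{Z}}|\beta-p|$, and for $\beta\in\mathbb{R}^d$ put $\|\beta\|_{\mathbb{Z}}=\sup_i\|\beta_i\|$. The vector $\alpha\in\mathbb{R}^d$ is of constant type if there exists $C>0$ such that $\|Q\alpha\|_{\mathbb{Z}}\ge C|Q|^{-1/d}$ for all $Q\in\mathbb{Z}\setminus\{0\}$. $B(x_0,r)$ denotes the open ball of center $x_0$ and radius $r$ in $\mathbb{T}^d$ for the distance $\|x-y\|_{\mathbb{Z}}$ induced by the sup norm; in particular $B(x_0,0)=\emptyset$. Let $(T,M,\mu)$ be a probability measure preserving system, $M$ a metric space. A sequence $\mathcal{A}=(A_n)_{n\in\mathbb{N}}$ of measurable sets with $\sum_{n=0}^\infty\mu(A_n)=\infty$ is called a Borel-Cantelli (BC) sequence for $T$ if $\mu(\limsup_n T^{-n}A_n)=1$, where $\limsup_n T^{-n}A_n=\bigcap_{n_0\in\mathbb{N}}\bigcup_{n\ge n_0}T^{-n}A_n$; equivalently, for $\mu$-almost every $x$ the set $\{n\in\mathbb{N}: T^n(x)\in A_n\}$ is infinite. STP: for every $x_0\in M$, every sequence of balls $(B(x_0,r_n))_{n\in\mathbb{N}}$ centered at $x_0$ with $\sum_n\mu(B(x_0,r_n))=\infty$ is BC for $T$. MSTP: for every $x_0\in M$, every sequence of balls $(B(x_0,r_n))_{n\in\mathbb{N}}$ with $0\le r_{n+1}\le r_n$ for all $n\in\mathbb{N}$ and $\sum_n\mu(B(x_0,r_n))=\infty$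 is BC for $T$. *)

(* Defs.v *)
From HB Require Import structures.
From mathcomp Require Import all_boot all_order all_algebra.
From mathcomp Require Import all_classical all_reals all_analysis.
From mathcomp Require Import ring_quotient ring lra measurable_realfun.
Import Order.TTheory GRing.Theory Num.Theory Quotient.

Set Implicit Arguments.
Unset Strict Implicit.
Unset Printing Implicit Defensive.

Local Open Scope classical_set_scope.
Local Open Scope ring_scope.

(* A base point is required of every measurableType; it plays no other role. *)
#[short(type="pmetricType")]
HB.structure Definition PMetric (K : numDomainType) :=
  {M of Metric K M & isPointed M}.

Definition borel (M : ptopologicalType) : Type := g_sigma_algebraType (@open M).
HB.instance Definition _ (M : ptopologicalType) :=
  Measurable.copy (borel M) (g_sigma_algebraType (@open M)).

Section shrinking_targets.
Context {R : realType} {M : pmetricType R}.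
Variables (mu : probability (borel M) R) (T : M -> M).
Local Open Scope ereal_scope.

Definition is_BC (A : (set M)^nat) : Prop :=
  [/\ forall n, measurable (A n : set (borel M)),
      \sum_(n <oo) mu (A n) = +oo &
      mu (lim_sup_set (fun n => iter n T @^-1` A n)) = 1].

(* In a metricType, [ball x r] is the open ball, so [ball x 0] is empty. *)
Definition STP : Prop :=
  forall (x0 : M) (r : R^nat), (forall n, (0 <= r n)%R) ->
    \sum_(n <oo) mu (ball x0 (r n)) = +oo ->
    is_BC (fun n => ball x0 (r n)).

Definition MSTP : Prop :=
  forall (x0 : M) (r : R^nat), (forall n, (0 <= r n.+1 <= r n)%R) ->
    \sum_(n <oo) mu (ball x0 (r n)) = +oo ->
    is_BC (fun n => ball x0 (r n)).

End shrinking_targets.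

Section distance_to_integers.
Context {R : realType}.

Definition distZ (b : R) : R := inf [set `|b - p%:~R| | p in [set: int]].

(* The default value 0 does not affect the maximum since distZ >= 0. *)
Definition normZ (d : nat) (b : 'rV[R]_d) : R :=
  \big[Num.max/0]_(i < d) distZ (b 0 i).

Definition constant_type (d : nat) (alpha : 'rV[R]_d) : Prop :=
  exists2 C : R, 0 < C &
    forall Q : int, Q != 0 ->
      C * (`|Q|%:~R `^ (- d%:R^-1)) <= normZ (alpha *~ Q).

Lemma distZ_le (b : R) (p : int) : distZ b <= `|b - p%:~R|.
Proof. by apply: ge_inf; [exists 0 => _ [q _ <-] | exists p]. Qed.

Lemma distZ_attained (b : R) : exists p : int, distZ b = `|b - p%:~R|.
Proof.
exists (Num.floor (b + 2^-1)); apply/eqP; rewrite eq_le distZ_le /=.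
have /andP[] := floor_itv (b + 2^-1); set p := Num.floor _.
rewrite intrD => p1 p2.
apply: lb_le_inf; first by exists `|b - 0%:~R|, 0.
move=> _ [q _ <-]; have [->//|] := eqVneq q p; rewrite neq_lt.
have lep : `|b - p%:~R| <= 2^-1 by rewrite ler_norml; apply/andP; split; lra.
move=> /orP[qp|pq]; apply: (le_trans lep).
- have : (q + 1)%:~R <= p%:~R :> R by rewrite ler_int lezD1.
  rewrite intrD => h; rewrite ger0_norm; lra.
- have : (p + 1)%:~R <= q%:~R :> R by rewrite ler_int lezD1.
  rewrite intrD => h; rewrite ler0_norm; lra.
Qed.

Lemma distZ_ge0 (b : R) : 0 <= distZ b.
Proof. by have [p ->] := distZ_attained b. Qed.

Lemma distZN (b : R) : distZ (- b) = distZ b.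
Proof.
suff h c : distZ (- c) <= distZ c.
  by apply/eqP; rewrite eq_le h -{1}[b]opprK h.
have [p ->] := distZ_attained c; apply: (le_trans (distZ_le _ (- p))).
by rewrite mulrNz opprK addrC distrC.
Qed.

Lemma distZD (b c : R) : distZ (b + c) <= distZ b + distZ c.
Proof.
have [p ->] := distZ_attained b; have [q ->] := distZ_attained c.
apply: (le_trans (distZ_le _ (p + q))); apply: le_trans (ler_normD _ _).
by rewrite intrD opprD addrACA.
Qed.

Lemma distZ_eq0 (b : R) : distZ b = 0 -> b \is a Num.int.
Proof.
have [p ->] := distZ_attained b => /normr0_eq0/subr0_eq->.
exact: intr_int.
Qed.

Lemma distZ_int (b : R) : b \is a Num.int -> distZ b = 0.
Proof.
move=> /intrP[p ->]; apply/eqP; rewrite eq_le distZ_ge0 andbT.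
by rewrite (le_trans (distZ_le _ p))// subrr normr0.
Qed.

Lemma distZ_le_norm (b : R) : distZ b <= `|b|.
Proof. by rewrite (le_trans (distZ_le _ 0))// subr0. Qed.

Context {d : nat}.
Implicit Types u v : 'rV[R]_d.

Lemma normZ_ge0 u : 0 <= normZ u.
Proof. exact: bigmax_ge_id. Qed.

Lemma le_normZ u i : distZ (u 0 i) <= normZ u.
Proof. exact: (le_bigmax_cond _ (fun i => distZ (u 0 i))). Qed.

Lemma normZ_le u (e : R) : 0 <= e -> (forall i, distZ (u 0 i) <= e) ->
  normZ u <= e.
Proof. by move=> e0 h; apply: bigmax_le. Qed.

Lemma normZN u : normZ (- u) = normZ u.
Proof. by apply: eq_bigr => i _; rewrite mxE distZN. Qed.

Lemma normZD u v : normZ (u + v) <= normZ u + normZ v.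
Proof.
apply: normZ_le => [|i]; first by rewrite addr_ge0 ?normZ_ge0.
by rewrite mxE (le_trans (distZD _ _))// lerD ?le_normZ.
Qed.

Definition int_rV : pred 'rV[R]_d :=
  fun v => [forall i, v 0 i \is a Num.int].

Lemma int_rV_zmod_closed : zmod_closed int_rV.
Proof.
split=> [|u v /forallP hu /forallP hv].
  by apply/forallP => i; rewrite mxE rpred0.
by apply/forallP => i; rewrite !mxE rpredB.
Qed.

HB.instance Definition _ :=
  GRing.isZmodClosed.Build 'rV[R]_d int_rV int_rV_zmod_closed.

Definition int_lattice : zmodClosed 'rV[R]_d :=
  GRing.ZmodClosed.clone 'rV[R]_d int_rV _.

Lemma normZ_eq0 u : (normZ u = 0) <-> (u \in int_lattice).
Proof.
split=> [u0|/forallP ui].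
  apply/forallP => i; apply: distZ_eq0; apply/eqP.
  by rewrite eq_le distZ_ge0 -u0 le_normZ.
apply/eqP; rewrite eq_le normZ_ge0 andbT.
by apply: normZ_le => // i; rewrite distZ_int.
Qed.

End distance_to_integers.

Section torus.
Variables (R : realType) (d : nat).

Definition torus : Type := {quot (@int_lattice R d)}.

HB.instance Definition _ := GRing.Zmodule.on torus.

HB.instance Definition _ := isPointed.Build torus 0.

Definition toT (x : 'rV[R]_d) : torus := \pi_({quot (@int_lattice R d)})%qT x.

(* The chosen representatives are irrelevant: see tdistE. *)
Definition tdist (x y : torus) : R := normZ (repr x - repr y).

Lemma toTD x y : toT (x + y) = toT x + toT y.
Proof. exact: raddfD. Qed.

Lemma toTB x y : toT (x - y) = toT x - toT y.
Proof. exact: raddfB. Qed.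

Lemma toTK (x : torus) : toT (repr x) = x.
Proof. exact: reprK. Qed.

Lemma toT_eq x y : (toT x = toT y) <-> (x - y \in @int_lattice R d).
Proof. by rewrite idealrBE; split => [/eqP|/eqP]. Qed.

Lemma tdistE x y : tdist (toT x) (toT y) = normZ (x - y).
Proof.
suff h u v : toT u = toT v -> normZ u <= normZ v.
  have e : toT (repr (toT x) - repr (toT y)) = toT (x - y).
    by rewrite !toTB !toTK.
  by apply/eqP; rewrite eq_le !h.
move=> /toT_eq/normZ_eq0 uv.
by rewrite -(subrK v u) (le_trans (normZD _ _))// uv add0r.
Qed.

Lemma tdistxx x : tdist x x = 0.
Proof. by rewrite /tdist subrr; apply/normZ_eq0/rpred0. Qed.

Lemma tdist_positivity x y : tdist x y = 0 -> x = y.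
Proof. by move=> /normZ_eq0/toT_eq; rewrite !toTK. Qed.

Lemma tdist_sym x y : tdist x y = tdist y x.
Proof. by rewrite /tdist -normZN opprB. Qed.

Lemma tdist_triangle y x z : tdist x z <= tdist x y + tdist y z.
Proof. by rewrite /tdist -(subrKA (repr y)) normZD. Qed.

HB.instance Definition _ := isMetric.Build R torus
  tdistxx tdist_positivity tdist_sym tdist_triangle.

Definition translation (alpha : 'rV[R]_d) : torus -> torus :=
  fun x => x + toT alpha.

(* The Haar probability measure of the compact group [torus]: the (unique)
   translation-invariant Borel probability measure; see Haar_exists. *)
Definition is_Haar (mu : probability (borel torus) R) : Prop :=
  forall (a : torus) (A : set torus), measurable (A : set (borel torus)) ->
    mu ((fun x => a + x) @^-1` A) = mu A.

End torus.

Section Haar_existence.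
Context {R : realType}.
Local Notation RT := (measurableTypeR R).
Local Notation leb := (@lebesgue_measure R).

Lemma lebesgue_measure_shift (a : R) (A : set R) :
  measurable (A : set RT) -> leb ((fun x => x + a) @^-1` A) = leb A.
Proof.
move=> mA.
have ma : measurable_fun [set: RT] (fun x : RT => x + a : RT).
  exact: measurable_funD.
pose ma' := isMeasurableFun.Build _ _ _ _ _ ma.
pose f : {mfun RT >-> RT} := HB.pack (fun x : RT => x + a : RT) ma'.
rewrite [RHS](@lebesgue_measure_unique R (pushforward leb f))//.
move=> _ [[b c]] _ <- /=.
rewrite /pushforward /=.
have -> : f @^-1` `]b, c] = `]b - a, c - a]%classic.
  apply/seteqP; split => x /=; rewrite !in_itv/=;
    by rewrite ltrBlDr lerBrDr.
rewrite !lebesgue_measure_itv/= !lte_fin ltrD2r.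
by case: ifP => // _; rewrite -!EFinB; congr (_%:E); lra.
Qed.

Let D := `[0, 1[%classic : set R.
Let mD : measurable (D : set RT). Proof. exact: measurable_itv. Qed.
Definition uniform01 : set RT -> \bar R := mrestr leb mD.
Let U1 : uniform01 setT = 1%E.
Proof.
by rewrite /uniform01 /mrestr setTI lebesgue_measure_itv/= lte_fin ltr01 oppr0 adde0.
Qed.
HB.instance Definition _ := Measure.on uniform01.
HB.instance Definition _ := Measure_isProbability.Build _ _ _ uniform01 U1.

Lemma rotation_invariant_dim1 (a : R) : exists f : RT -> RT,
  [/\ measurable_fun setT f, forall x, f x - (x + a) \is a Num.int &
      forall A, measurable A -> uniform01 (f @^-1` A) = uniform01 A].
Proof.
have /andP[] := floor_itv a; set k := Num.floor a; rewrite intrD => ka ak.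
pose b := a - k%:~R; have b0 : 0 <= b by rewrite /b; lra.
have b1 : b < 1 by rewrite /b; lra.
pose f (x : RT) : RT := if x < 1 - b then x + b else x + (b - 1).
have mf : measurable_fun setT f.
  by apply: measurable_fun_ifT;
    [exact: measurable_fun_ltr | exact: measurable_funD | exact: measurable_funD].
exists f; split => //.
  move=> x; rewrite /f; case: ifP => _.
  - have -> : x + b - (x + a) = - k%:~R by rewrite /b; lra.
    by rewrite rpredN intr_int.
  - have -> : x + (b - 1) - (x + a) = - k%:~R - 1 by rewrite /b; lra.
    by rewrite rpredB ?rpredN ?intr_int ?rpred1.
move=> A mA; rewrite /uniform01 /mrestr.
have mfA : measurable (f @^-1` A) by rewrite -[X in measurable X]setTI; exact: mf.
pose D1 := `[0, 1 - b[%classic : set R; pose D2 := `[1 - b, 1[%classic : set R.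
pose E1 := `[b, 1[%classic : set R; pose E2 := `[0, b[%classic : set R.
have mI (x y : R) : measurable (`[x, y[%classic : set RT) by exact: measurable_itv.
have DD : D = D1 `|` D2.
  rewrite /D /D1 /D2; apply/seteqP; split=> x /=; rewrite !in_itv/=.
    by move=> /andP[h1 h2]; case: (ltP x (1 - b)) => ?; [left|right]; lra.
  by move=> [] /andP[h1 h2]; lra.
have DE : D = E1 `|` E2.
  rewrite /D /E1 /E2; apply/seteqP; split=> x /=; rewrite !in_itv/=.
    by move=> /andP[h1 h2]; case: (ltP x b) => ?; [right|left]; lra.
  by move=> [] /andP[h1 h2]; lra.
rewrite {1}DD DE !setIUr !measureU//; try by apply: (@measurableI _ RT) => //; exact: mI.
- congr (_ + _)%E.
  + rewrite -[RHS](lebesgue_measure_shift b); last by apply: (@measurableI _ RT) => //; exact: mI.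
    congr (leb _); rewrite /D1 /D2 /E1 /E2.
    apply/seteqP; split => x /=; rewrite !in_itv/= /f.
      by move=> [+ /andP[h1 h2]]; rewrite h2 => ?; split => //; lra.
    move=> [? /andP[h1 h2]]; have h : x < 1 - b by lra.
    by rewrite h; split => //; lra.
  + rewrite -[RHS](lebesgue_measure_shift (b - 1)); last by apply: (@measurableI _ RT) => //; exact: mI.
    congr (leb _); rewrite /D1 /D2 /E1 /E2.
    apply/seteqP; split => x /=; rewrite !in_itv/= /f.
      move=> [+ /andP[h1 h2]]; rewrite ltNge h1/= => ?; split => //; lra.
    move=> [? /andP[h1 h2]]; have h : 1 - b <= x by lra.
    by rewrite ltNge h/=; split => //; lra.
- rewrite /D1 /D2 /E1 /E2; apply/seteqP; split => x //= -[[_ +] [_ +]]; rewrite !in_itv/=.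
  by move=> /andP[? ?] /andP[? ?]; lra.
- rewrite /D1 /D2 /E1 /E2; apply/seteqP; split => x //= -[[_ +] [_ +]]; rewrite !in_itv/=.
  by move=> /andP[? ?] /andP[? ?]; lra.
Qed.

(* The witness is the law of n independent uniform variables on [0, 1[;
   invariance is stated through maps that agree with x |-> x + a modulo 1. *)
Lemma rotation_invariant_dim (n : nat) :
  exists P : probability (n.-tuple RT) R, forall a : n.-tuple R,
  exists f : n.-tuple RT -> n.-tuple RT,
  [/\ measurable_fun setT f,
      forall x i, tnth (f x) i - (tnth x i + tnth a i) \is a Num.int &
      forall A, measurable A -> P (f @^-1` A) = P A].
Proof.
elim: n => [|n [P IH]].
  exists (\d_([tuple] : 0.-tuple RT)) => a; exists id; split => //.
  by move=> x [].
have mc : measurable_fun [set: RT * n.-tuple RT]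
    (fun x : RT * n.-tuple RT => [the n.+1.-tuple RT of x.1 :: x.2]).
  exact: measurable_cons.
pose mc' := isMeasurableFun.Build _ _ _ _ _ mc.
pose c : {mfun (RT * n.-tuple RT)%type >-> (n.+1.-tuple RT)} := HB.pack
  (fun x : RT * n.-tuple RT => [the n.+1.-tuple RT of x.1 :: x.2]) mc'.
pose Q : probability (RT * n.-tuple RT)%type R := (uniform01 \x P)%E.
exists (distribution Q c) => a.
have [f [mf fa fU]] := rotation_invariant_dim1 (thead a).
have [g [mg ga gP]] := IH [tuple of behead a].
pose h (t : n.+1.-tuple RT) : n.+1.-tuple RT :=
  [the n.+1.-tuple RT of f (thead t) :: g [tuple of behead t]].
have mh : measurable_fun setT h.
  apply: measurable_cons.
    by apply: measurableT_comp => //; exact: measurable_tnth.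
  by apply: measurableT_comp => //; exact: measurable_behead.
exists h; split => //.
  move=> x i; case: (unliftP ord0 i) => [j ->|->].
    rewrite /h tnthS; have := ga [tuple of behead x] j.
    have E (t : n.+1.-tuple R) :
        tnth [tuple of behead t] j = tnth t (lift ord0 j).
      by case/tupleP: t => y t; rewrite tnthS; congr tnth; exact/val_inj.
    by rewrite -2!E.
  by rewrite /h tnth0; exact: fa.
move=> A mA.
rewrite /distribution /pushforward /=.
have mcA : measurable (c @^-1` A) by rewrite -[X in measurable X]setTI; exact: (mc measurableT).
have mhA : measurable (h @^-1` A) by rewrite -[X in measurable X]setTI; exact: (mh measurableT).
have mchA : measurable (c @^-1` (h @^-1` A)).
  by rewrite -[X in measurable X]setTI; exact: (mc measurableT).
rewrite /Q /= /product_measure1.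
set C := c @^-1` A.
have E x : xsection (c @^-1` (h @^-1` A)) x = g @^-1` xsection C (f x).
  apply/seteqP; split => y; rewrite /xsection/= !inE /C/= /h/=;
    rewrite (_ : [tuple of behead [tuple of x :: y]] = y)//;
    exact/val_inj.
under eq_integral => x _.
  rewrite /= E gP; last exact: measurable_xsection.
  over.
have mP := @measurable_fun_xsection _ _ _ _ R P C mcA.
have := ge0_integral_pushforward mf uniform01 measurableT mP.
rewrite preimage_setT => /(_ _)/esym /= -> //.
pose mf' := isMeasurableFun.Build _ _ _ _ _ mf.
pose f' : {mfun RT >-> RT} := HB.pack f mf'.
by apply: (@eq_measure_integral _ _ _ _ _ (pushforward uniform01 f')) => B mB _; exact: fU.
Qed.

Variable d : nat.

Let phi (t : d.-tuple RT) : torus R d := toT (\row_i tnth t i).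

Lemma measurable_tuple_torus : measurable_fun setT (phi : _ -> borel (torus R d)).
Proof.
apply: (@measurability _ _ (d.-tuple RT) (borel (torus R d)) setT phi (@open (torus R d))) => // _ [V oV <-]; rewrite setTI.
pose q (x : d.-tuple rat) : d.-tuple RT := [tuple ratr (tnth x i) | i < d].
pose F (xk : d.-tuple rat * nat) : set (d.-tuple RT) :=
  [set t | ball (phi (q xk.1)) (xk.2.+1%:R^-1) `<=` V /\
     forall i, `|tnth t i - tnth (q xk.1) i| < xk.2.+1%:R^-1].
have dphi s t e : (0 < e) -> (forall i, `|tnth t i - tnth s i| < e) ->
    ball (phi s) e (phi t).
  move=> e0 h; rewrite /ball/= /phi tdistE.
  apply: bigmax_lt => // i _; rewrite !mxE.
  by rewrite (le_lt_trans (distZ_le_norm _))// distrC.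
rewrite (_ : _ @^-1` V = \bigcup_xk F xk); last first.
  apply/seteqP; split => [t Vt|t [[x k] _ [/= h1 h2]]]; last first.
    by apply: h1; exact: dphi.
  have [e /= e0 eV] : exists2 e : R, 0 < e & ball (phi t) e `<=` V.
    have /nbhs_ballP[e /= e0 eV] : nbhs (phi t) V by exact: open_nbhs_nbhs.
    by exists e.
  have [k ke] : exists k : nat, k.+1%:R^-1 < e / 2.
    have [k] := ltr_add_invr (divr_gt0 e0 (ltr0n R 2)).
    by rewrite add0r; exists k.
  have hq i : exists p : rat, `|tnth t i - ratr p| < k.+1%:R^-1.
    have k0 : 0 < k.+1%:R^-1 :> R by rewrite invr_gt0.
    have : tnth t i - k.+1%:R^-1 < tnth t i + k.+1%:R^-1.
      by rewrite ltrBlDr -addrA ltrDl addr_gt0.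
    move=> /rat_in_itvoo[p]; rewrite in_itv/= => /andP[p1 p2].
    by exists p; rewrite ltr_distlC p1.
  have [p hp] := choice hq.
  exists ([tuple p i | i < d], k) => //; split => /=.
  - apply: subset_trans eV => y ky.
    have : ball (phi t) (k.+1%:R^-1 + k.+1%:R^-1) y.
      apply: ball_triangle ky; apply: ball_sym; apply: dphi => [|i].
        by rewrite invr_gt0.
      by rewrite !tnth_mktuple.
    by apply: le_ball; rewrite (splitr e) ltW// ltrD.
  - by move=> i; rewrite !tnth_mktuple.
apply: countable_bigcupT_measurable => // -[x k].
rewrite /F /=; set r := k.+1%:R^-1.
have [hV|hV] := pselect (ball (phi (q x)) r `<=` V); last first.
  by rewrite (_ : [set t | _] = set0)//; apply/seteqP; split => t // -[].
rewrite (_ : [set t | _] = \big[setI/setT]_(i < d)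
    ((fun t : d.-tuple RT => tnth t i : RT) @^-1` (ball (tnth (q x) i : R^o) r))).
  apply: bigsetI_measurable => i _; rewrite -[X in measurable X]setTI.
  exact: (@measurable_tnth _ RT d i measurableT _ (measurable_ball _ _)).
rewrite -bigcap_seq; apply/seteqP; split => [t [_ h] i _|t h].
  by have := h i; rewrite /ball/= distrC.
split => // i.
by have := h i (mem_index_enum i); rewrite /ball/= distrC.
Qed.

Lemma Haar_exists : exists mu : probability (borel (torus R d)) R, is_Haar mu.
Proof.
have [P hP] := rotation_invariant_dim d.
pose mphi' := isMeasurableFun.Build _ _ _ _ _ measurable_tuple_torus.
pose phi' : {mfun (d.-tuple RT) >-> borel (torus R d)} := HB.pack
  (phi : _ -> borel (torus R d)) mphi'.
exists (distribution P phi') => a A mA.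
have [f [mf fa fP]] := hP [tuple repr a 0 i | i < d].
rewrite /distribution /pushforward /=.
rewrite -[RHS]fP; last first.
  by rewrite -[X in measurable X]setTI; exact: measurable_tuple_torus.
congr (P _); apply/seteqP.
suff E t : a + phi t = phi (f t) by split => t /=; rewrite E.
rewrite -{1}[a]toTK /phi -toTD; apply/esym/toT_eq/forallP => i.
by have := fa t i; rewrite !mxE tnth_mktuple [tnth t i + _]addrC.
Qed.

End Haar_existence.

(* Main.v *)
Require Import Defs.
From HB Require Import structures.
From mathcomp Require Import all_boot all_order all_algebra.
From mathcomp Require Import all_classical all_reals all_analysis.
From mathcomp Require Import ring lra zify.
Import Order.TTheory GRing.Theory Num.Theory.
Local Open Scope classical_set_scope.
Local Open Scope ring_scope.

(** Throughout, [a] is the image of [alpha] in the torus and [tnorm x] the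
    distance from [x] to 0, so that [x] enters [ball x0 r] at time [n] exactly
    when [x] lies in the ball of radius [r] about [x0 - n a].

    Constant type means that the first [N] points of the orbit of 0 are
    separated by a constant times [N^(-1/d)], the largest order allowed by
    volume.  Packing balls of half that radius shows that at most a constant
    times [N * ballvol r] of the first [N] multiples of [a] have norm less than
    [2 r] ([orbit_count]).  For decreasing radii the balls about [x0 - n a] are
    therefore quasi-independent: if [S] is the sum of their volumes, the
    overlaps amount to at most [A * S ^ 2], and a stretch of the sequence with
    [S] of order [1/A] covers a definite mass ([orbit_union_lower]).  As this
    applies to every tail, the limsup set has positive measure.

    To get full measure, let [W] be the complement of the limsup set.  Radii
    decrease, so [W] contains its preimage under the translation, and [mu]
    restricted to [W] is invariant under the translation
    ([restriction_invariant]).  The orbit of 0 is dense ([orbit_dense]), so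
    this restriction gives equal masses to balls of equal radius.  That is the
    only property of the measure on which the covering argument relies; were
    [mu W] positive, the restriction would charge the limsup set, which is
    disjoint from [W].

    If [alpha] is not of constant type, some [Q a] is extremely close to 0.
    The first [N = K Q] orbit points then cluster around the first [Q] of them,
    and balls of radius [N^(-1/d)], whose volumes add up to order 1, cover a set
    of measure of order only [1/K] ([small_orbit_union]).  Blocks of such radii
    yield a decreasing sequence with divergent sum and null limsup set
    ([null_orbit_target]).

    For the third claim, take [r n] to be half of [tnorm (n a)] along times at
    which [n a] tends to 0, and 0 otherwise.  A point [y] in the ball of radius
    [r n] about [n a] has [0 < tnorm y < 2 * tnorm (n a)], so each [y] is hit
    only finitely often; since [alpha] is irrational, returns of size comparable
    to any given small one are infinitely many, and the sum can be made to
    diverge ([escaping_targets]).  The failure of STP follows: if [alpha] is of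
    constant type it is irrational and the third claim applies, otherwise
    already MSTP fails. *)

Set Implicit Arguments.
Unset Strict Implicit.
Unset Printing Implicit Defensive.

(** * The sup norm on the torus *)

Section torus_geometry.
Context {R : realType} {d : nat}.
Local Notation TT := (torus R d).
Implicit Types (x y z : TT) (u v : 'rV[R]_d).

Definition tnorm x : R := tdist x 0.

Lemma toT0 : toT 0 = 0 :> TT.
Proof. by rewrite -(subrr (0 : 'rV[R]_d)) toTB subrr. Qed.

Lemma toTMn u n : toT (u *+ n) = toT u *+ n :> TT.
Proof. by elim: n => [|n IH]; rewrite ?toT0// !mulrS toTD IH. Qed.

Lemma tnorm_toT u : tnorm (toT u) = normZ u.
Proof. by rewrite /tnorm -toT0 tdistE subr0. Qed.

Lemma tdist_tnorm x y : tdist x y = tnorm (x - y).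
Proof. by rewrite -(toTK x) -(toTK y) -toTB tnorm_toT tdistE. Qed.

Lemma ballE x r y : ball x r y = (tnorm (x - y) < r) :> Prop.
Proof. by rewrite -tdist_tnorm. Qed.

Lemma tnorm0 : tnorm 0 = 0.
Proof. exact: tdistxx. Qed.

Lemma tnorm_eq0 x : tnorm x = 0 -> x = 0.
Proof. exact: tdist_positivity. Qed.

Lemma tnorm_ge0 x : 0 <= tnorm x.
Proof. exact: normZ_ge0. Qed.

Lemma tnorm_gt0 x : (0 < tnorm x) = (x != 0).
Proof.
rewrite lt_neqAle tnorm_ge0 andbT; congr negb; apply/eqP/eqP => [/esym|->].
  exact: tnorm_eq0.
by rewrite tnorm0.
Qed.

Lemma tnormN x : tnorm (- x) = tnorm x.
Proof. by rewrite -(toTK x) -[- _]sub0r -toT0 -toTB sub0r !tnorm_toT normZN. Qed.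

Lemma tnormB x y : tnorm (x - y) = tnorm (y - x).
Proof. by rewrite -tnormN opprB. Qed.

Lemma tnormD x y : tnorm (x + y) <= tnorm x + tnorm y.
Proof. by rewrite -(toTK x) -(toTK y) -toTD !tnorm_toT normZD. Qed.

Lemma tnormMn x n : tnorm (x *+ n) <= n%:R * tnorm x.
Proof.
elim: n => [|n IH]; first by rewrite mulr0n tnorm0 mul0r.
by rewrite mulrS (le_trans (tnormD _ _))// mulrS mulrDl mul1r lerD2l.
Qed.

(** Divisibility is what allows [orbit_dense] to pass from a multiple of an
    arbitrary point to the point itself. *)
Lemma torus_divisible x n : (0 < n)%N -> exists y, y *+ n = x.
Proof.
move=> n0; exists (toT (n%:R^-1 *: repr x)).
rewrite -toTMn -scaler_nat scalerA mulfV ?scale1r ?toTK//.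
by rewrite pnatr_eq0 -lt0n.
Qed.

Lemma tnorm_le_half x : tnorm x <= 2^-1.
Proof.
rewrite -(toTK x) tnorm_toT; apply: normZ_le; first by rewrite invr_ge0.
move=> i; set b := _ 0 i.
have [p1 p2] := andP (floor_itv (b + 2^-1)).
apply: le_trans (distZ_le b (Num.floor (b + 2^-1))) _.
move: p1 p2; rewrite intrD => p1 p2; rewrite ler_norml; apply/andP; split; lra.
Qed.

End torus_geometry.

(** * Grids *)

Section grid.
Context {R : realType} {d : nat}.
Local Notation TT := (torus R d).

(** The grid of step [1 / n.+1] is at once separated and a net at that scale:
    comparing a ball with its translates to the grid bounds its volume from
    both sides without any formula for the measure. *)
Definition grid n (f : {ffun 'I_d -> 'I_n.+1}) : TT :=
  toT (\row_i ((f i)%:R / n.+1%:R)).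

Lemma grid_separated n (f g : {ffun 'I_d -> 'I_n.+1}) : f != g ->
  n.+1%:R^-1 <= tnorm (grid f - grid g).
Proof.
move=> fg; have [i fgi] : exists i, f i != g i.
  by apply/existsP; rewrite -negb_forall; apply: contra fg => /forallP h;
    apply/eqP/ffunP => i; apply/eqP.
rewrite /grid -toTB tnorm_toT; apply: le_trans (le_normZ _ i); rewrite !mxE.
set b := (X in distZ X); have [p ->] := distZ_attained b; rewrite /b => {b}.
have n0 : 0 < n.+1%:R :> R by [].
rewrite -[leLHS]mul1r ler_pdivrMr// -[X in _ * X](gtr0_norm n0) -normrM.
have -> : ((f i)%:R / n.+1%:R - (g i)%:R / n.+1%:R - p%:~R) * n.+1%:R =
    ((f i : nat)%:Z - (g i : nat)%:Z - p * n.+1%:Z)%:~R :> R.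
  rewrite !(intrB, intrM) -!pmulrn; field; lra.
rewrite -intr_norm -[1]/(1%:~R) ler_int.
have : (f i < n.+1)%N by []; have : (g i < n.+1)%N by [].
have /eqP : (f i : nat) != g i by [].
move: (nat_of_ord (f i)) (nat_of_ord (g i)) => a b ab bn an.
(* [a - b] has absolute value below [n.+1], so no multiple of [n.+1] other than
   0 can cancel it *)
have [p1|[p1|p1]] : p <= -1 \/ p = 0 \/ 1 <= p by lia.
- by nia.
- by rewrite p1; lia.
- by nia.
Qed.

Lemma grid_net n (x : TT) : exists f : {ffun 'I_d -> 'I_n.+1},
  tnorm (x - grid f) < n.+1%:R^-1.
Proof.
pose k i := Num.floor (repr x 0 i * n.+1%:R).
have km i : (`|(k i %% n.+1%:Z)%Z|%N < n.+1)%N by lia.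
exists [ffun i => Ordinal (km i)].
rewrite -{1}(toTK x) /grid -toTB tnorm_toT.
have n0 : 0 < n.+1%:R :> R by [].
apply: bigmax_lt => [|i _]; first by rewrite invr_gt0.
apply: le_lt_trans (distZ_le _ (k i %/ n.+1%:Z)%Z) _.
rewrite !mxE ffunE/=; set q := (k i %/ _)%Z.
have kq : `|(k i %% n.+1%:Z)%Z|%N%:R = (k i)%:~R - q%:~R * n.+1%:R :> R.
  rewrite [LHS]pmulrn gez0_abs ?modz_ge0//; have := divz_eq (k i) n.+1%:Z.
  by move: (k i %% _)%Z => s ->; rewrite intrD intrM -/q addrAC subrr add0r.
have /andP[] := floor_itv (repr x 0 i * n.+1%:R); rewrite -/(k i) intrD => h1 h2.
rewrite kq -[ltRHS]mul1r ltr_pdivlMr// -[X in _ * X](gtr0_norm n0) -normrM.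
rewrite (_ : _ * _ = repr x 0 i * n.+1%:R - (k i)%:~R).
  by rewrite ger0_norm; lra.
field; lra.
Qed.

Lemma card_grid n : #|{ffun 'I_d -> 'I_n.+1}| = (n.+1 ^ d)%N.
Proof. by rewrite card_ffun !card_ord. Qed.

End grid.

(** * Finite unions under a finite measure *)

Section finite_unions.
Context {R : realType} {dd : measure_display} {T : measurableType dd}.
Variable nu : {finite_measure set T -> \bar R}.

Lemma fine_measure_le (A B : set T) : measurable A -> measurable B ->
  A `<=` B -> fine (nu A) <= fine (nu B).
Proof.
move=> mA mB AB; apply: fine_le; rewrite ?fin_num_measure//.
by apply: le_measure; rewrite ?inE.
Qed.

Lemma fine_measure_ge0 (A : set T) : 0 <= fine (nu A).
Proof. exact/fine_ge0/measure_ge0. Qed.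

Lemma fine_sub_sum (I : finType) (A : I -> set T) (B : set T) :
  (forall i, measurable (A i)) -> measurable B ->
  B `<=` \bigcup_i A i -> fine (nu B) <= \sum_i fine (nu (A i)).
Proof.
move=> mA mB BA; rewrite -lee_fin fineK ?fin_num_measure// -sumEFin.
have mA' i : [set: I] i -> measurable (A i) by [].
apply: le_trans (content_sub_fsum nu finite_finset mA' mB BA) _.
rewrite fsbig_finite//= le_eqVlt; apply/orP; left; apply/eqP.
rewrite (perm_big (index_enum I)).
  by apply: eq_bigr => i _; rewrite fineK ?fin_num_measure.
apply: uniq_perm => [| |i]; rewrite ?finmap.fset_uniq ?index_enum_uniq//.
rewrite mem_index_enum (in_fset_set finite_finset).
by apply/idP/idP; rewrite inE.
Qed.

Lemma fine_sum_sub (I : finType) (P : pred I) (A : I -> set T) (B : set T) :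
  (forall i, measurable (A i)) -> measurable B ->
  (forall i j, P i -> P j -> i != j -> A i `&` A j = set0) ->
  (forall i, P i -> A i `<=` B) -> \sum_(i | P i) fine (nu (A i)) <= fine (nu B).
Proof.
move=> mA mB tA AB.
have tI : trivIset [set i | P i] A.
  apply/trivIsetP => i j Pi Pj ij; exact: tA.
have := @measure_fin_bigcup _ _ _ nu _ [set i | P i] A finite_finset tI (fun i _ => mA i).
rewrite (fsbig_finite _ _ finite_finset)/=.
move=> e; rewrite -lee_fin fineK ?fin_num_measure//.
apply: (@le_trans _ _ (nu (\bigcup_(i in [set i | P i]) A i))); last first.
  apply: le_measure; rewrite ?inE//.
    by apply: fin_bigcup_measurable => //; exact: finite_finset.
  by apply: bigcup_sub => i; exact: AB.
rewrite e -sumEFin le_eqVlt; apply/orP; left; apply/eqP.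
rewrite -[LHS]big_filter (perm_big (finmap.enum_fset (fset_set [set i | P i]))).
  by apply: eq_bigr => i _; rewrite fineK ?fin_num_measure.
apply: uniq_perm => [| |i]; rewrite ?finmap.fset_uniq ?filter_uniq ?index_enum_uniq//.
rewrite mem_filter mem_index_enum andbT (in_fset_set finite_finset).
by apply/idP/idP; rewrite inE.
Qed.

End finite_unions.

(** * Volumes of balls *)

Section ball_volume.
Context {R : realType} {d : nat}.
Local Notation TT := (torus R d).
Variable nu : {finite_measure set (borel TT) -> \bar R}.

Lemma measurable_ball (x : TT) r : measurable (ball x r : set (borel TT)).
Proof.
apply: sub_gen_smallest; rewrite /= openE => y /=; rewrite ballE => xy.
apply/nbhs_ballP; exists (r - tnorm (x - y)); first by rewrite /= subr_gt0.
move=> z; rewrite !ballE => yz; rewrite -(subrKA y).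
by apply: le_lt_trans (tnormD _ _) _; lra.
Qed.

(** This is weaker than invariance under all translations, and it can be checked
    for the restriction of [mu] to a set that is merely invariant under one
    translation with dense orbits; see [dense_orbit_homogeneous]. *)
Definition ball_homogeneous := forall (x y : TT) r,
  nu (ball x r) = nu (ball y r).

Definition ballvol r : R := fine (nu (ball (0 : TT) r)).
Definition mass : R := fine (nu setT).

Lemma ballvol_ge0 r : 0 <= ballvol r.
Proof. exact: fine_measure_ge0. Qed.

Lemma le_ballvol r s : r <= s -> ballvol r <= ballvol s.
Proof.
move=> rs; apply: fine_measure_le; try exact: measurable_ball.
exact: le_ball.
Qed.

Lemma ballvol_le_mass r : ballvol r <= mass.
Proof. by apply: fine_measure_le => //; exact: measurable_ball. Qed.

Hypothesis nuh : ball_homogeneous.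

Lemma ballvolE (x : TT) r : nu (ball x r) = (ballvol r)%:E.
Proof.
rewrite /ballvol fineK; first exact: nuh.
by apply: fin_num_measure; exact: measurable_ball.
Qed.

Lemma packing (I : finType) (P : pred I) (c : I -> TT) (delta : R) (B : set TT) :
  measurable (B : set (borel TT)) ->
  (forall i j, P i -> P j -> i != j -> delta <= tnorm (c i - c j)) ->
  (forall i, P i -> ball (c i) (delta / 2) `<=` B) ->
  #|P|%:R * ballvol (delta / 2) <= fine (nu B).
Proof.
move=> mB sep cB.
have h : \sum_(i | P i) fine (nu (ball (c i) (delta / 2))) <= fine (nu B).
  apply: fine_sum_sub => // [i|i j Pi Pj ij]; first exact: measurable_ball.
  apply/seteqP; split => // x []; rewrite !ballE => ix jx.
  have := sep i j Pi Pj ij; rewrite -(subrKA x) => /le_trans/(_ (tnormD _ _)).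
  by rewrite (tnormB x); lra.
rewrite mulr_natl -sumr_const; apply: le_trans h.
by rewrite le_eqVlt; apply/orP; left; apply/eqP/eq_bigr => i _; rewrite ballvolE.
Qed.

Lemma ballvol_lower r : 0 < r -> r <= 1 -> (r / 2) ^+ d * mass <= ballvol r.
Proof.
move=> r0 r1; have ri : 0 <= r^-1 by rewrite invr_ge0 ltW.
have /andP[n1 n2] := truncn_itv ri; set n := Num.truncn _ in n1 n2.
have n0 : 0 < n.+1%:R :> R by [].
(* [n.+1] lies between [1 / r] and [2 / r] *)
have h1 : n.+1%:R^-1 <= r by rewrite invf_ple ?posrE// ltW.
have h2 : r / 2 <= n.+1%:R^-1.
  rewrite -[leRHS]mul1r ler_pdivlMr// -(natr1 n).
  have := ler_wpM2l (ltW r0) n1; rewrite mulfV ?gt_eqF//; lra.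
have : mass <= \sum_(f : {ffun 'I_d -> 'I_n.+1}) fine (nu (ball (grid f : TT) r)).
  apply: fine_sub_sum => // [f|x _]; first exact: measurable_ball.
  have [f fx] := grid_net n x; exists f => //.
  by rewrite ballE tnormB (lt_le_trans fx).
rewrite (eq_bigr (fun=> ballvol r)) => [|f _]; last by rewrite ballvolE.
rewrite sumr_const card_grid -[X in _ <= X -> _]mulr_natl natrX.
rewrite -ler_pdivrMl ?exprn_gt0//; apply: le_trans.
rewrite -exprVn ler_wpM2r ?fine_measure_ge0// lerXn2r//.
  by rewrite nnegrE divr_ge0// ltW.
by rewrite nnegrE invr_ge0.
Qed.

Lemma ballvol_upper r : 0 < r -> ballvol r <= (4 * r) ^+ d * mass.
Proof.
move=> r0; have [r4|r4] := ltP 4^-1 r.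
  rewrite (le_trans (ballvol_le_mass r))// -[leLHS]mul1r.
  by rewrite ler_wpM2r ?fine_measure_ge0// exprn_ege1//; lra.
have ri : 0 <= (4 * r)^-1 by rewrite invr_ge0; lra.
have /andP[n1 n2] := truncn_itv ri; set n := Num.truncn _ in n1 n2.
have n0 : 0 < n.+1%:R :> R by [].
have r40 : 4 * r != 0 by lra.
(* [n.+1] lies between [1 / (4 r)] and [1 / (2 r)] *)
have h1 : n.+1%:R^-1 <= 4 * r by rewrite invf_ple ?posrE ?ltW//; lra.
have h2 : 2 * r <= n.+1%:R^-1.
  rewrite -[leRHS]mul1r ler_pdivlMr// -(natr1 n).
  have e : r * (4 * r)^-1 = 4^-1 by field; lra.
  have := ler_wpM2l (ltW r0) n1; rewrite e; lra.
have := @packing _ predT (fun f : {ffun 'I_d -> 'I_n.+1} => grid f : TT) (2 * r) setT.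
rewrite card_grid natrX -/mass mulrAC divff// mul1r => h.
have {h} : n.+1%:R ^+ d * ballvol r <= mass.
  by apply: h => // i j _ _ ij; apply: le_trans (grid_separated ij).
rewrite -ler_pdivlMl ?exprn_gt0//; move/le_trans; apply.
by rewrite -exprVn ler_wpM2r ?fine_measure_ge0// lerXn2r ?nnegrE ?invr_ge0//; lra.
Qed.

Lemma ballvol_gt0 r : 0 < mass -> 0 < r -> 0 < ballvol r.
Proof.
move=> m0 r0; apply: lt_le_trans (le_ballvol (_ : Num.min r 1 <= r)).
  apply: lt_le_trans (ballvol_lower _ _).
  - by rewrite mulr_gt0// exprn_gt0// divr_gt0// lt_min r0/=.
  - by rewrite lt_min r0/=.
  - by rewrite ge_min lexx orbT.
by rewrite ge_min lexx.
Qed.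

Lemma ballvol_triple r : 0 < r -> ballvol (3 * r) <= 24 ^+ d * ballvol r.
Proof.
move=> r0; have [r1|r1] := leP r 1.
  apply: le_trans (ballvol_upper _) _; first lra.
  apply: le_trans (ler_wpM2l _ (ballvol_lower r0 r1)); last exact: exprn_ge0.
  rewrite [leRHS]mulrA -[X in _ <= X * _]exprMn (_ : 24 * (r / 2) = 4 * (3 * r))//.
  by field.
apply: le_trans (ballvol_le_mass _) _.
have c0 : 0 <= 24 ^+ d :> R by exact: exprn_ge0.
apply: le_trans (ler_wpM2l c0 (le_ballvol (ltW r1))).
apply: le_trans (ler_wpM2l c0 (ballvol_lower ltr01 (lexx 1))).
rewrite [leRHS]mulrA -[X in _ <= X * _]exprMn -[leLHS]mul1r.
rewrite ler_wpM2r ?fine_measure_ge0// exprn_ege1//; lra.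
Qed.

End ball_volume.

(** * Badly approximable points *)

Section roots.
Context {R : realType}.

Lemma exists_root d (x : R) : (0 < d)%N -> 0 < x ->
  exists2 y : R, 0 < y & y ^+ d = x.
Proof.
move=> d0 x0; exists (x `^ d%:R^-1); first exact: powR_gt0.
by rewrite -powR_mulrn ?powR_ge0// -powRrM mulVf ?pnatr_eq0 -?lt0n// powRr1// ltW.
Qed.

End roots.

Lemma absz_sub_lt (i j n : nat) : (i < n)%N -> (j < n)%N ->
  (`|i%:Z - j%:Z| < n)%N.
Proof. lia. Qed.

Lemma absz_sub_gt0 (i j : nat) : i != j -> (0 < `|i%:Z - j%:Z|)%N.
Proof. lia. Qed.

Lemma subz_SS (i j : nat) : i.+1%:Z - j.+1%:Z = i%:Z - j%:Z.
Proof. lia. Qed.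

Section return_times.
Context {R : realType} {d : nat}.
Local Notation TT := (torus R d).
Hypothesis d_gt0 : (0 < d)%N.

(** Constant type, stated for a point of the torus and with the [d]-th power on
    the other side, which removes the exponent [-1/d]. *)
Definition badly_approximable (C : R) (a : TT) :=
  0 < C /\ forall n, (0 < n)%N -> C <= n%:R * tnorm (a *+ n) ^+ d.

Lemma toTMz (u : 'rV[R]_d) (k : int) : toT (u *~ k) = toT u *~ k :> TT.
Proof.
case: k => n; first exact: toTMn.
by rewrite !NegzE !mulrNz -!pmulrn -toTMn -[RHS]sub0r -toT0 -toTB sub0r.
Qed.

Lemma tnormMz (a : TT) (k : int) : tnorm (a *~ k) = tnorm (a *+ `|k|%N).
Proof. by case: k => n //; rewrite NegzE mulrNz tnormN. Qed.

Lemma constant_typeP (alpha : 'rV[R]_d) :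
  constant_type alpha <-> exists C, badly_approximable C (toT alpha).
Proof.
have rt (n : nat) : (0 < n)%N -> (n%:R `^ (- d%:R^-1)) ^+ d = n%:R^-1 :> R.
  move=> n0; rewrite -powR_mulrn ?powR_ge0// -powRrM mulNr mulVf ?pnatr_eq0 -?lt0n//.
  by rewrite powRN powRr1.
split=> [[C C0 h]|[C [C0 h]]].
  exists (C ^+ d); split; first exact: exprn_gt0.
  move=> n n0; have := h n%:Z; rewrite -tnorm_toT toTMz tnormMz/= -lt0n => /(_ n0) {}h.
  rewrite mulrC -ler_pdivrMr ?ltr0n// -rt// -exprMn lerXn2r// nnegrE.
    by rewrite mulr_ge0 ?powR_ge0// ltW.
  exact: tnorm_ge0.
have [D D0 DC] := exists_root d_gt0 C0; exists D => // Q Q0.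
rewrite -tnorm_toT toTMz tnormMz -abszE -pmulrn.
have n0 : (0 < `|Q|)%N by rewrite absz_gt0.
have := h _ n0; rewrite mulrC -ler_pdivrMr ?ltr0n// -(rt _ n0) -DC -exprMn.
by rewrite ler_pXn2r// nnegrE ?tnorm_ge0// mulr_ge0 ?powR_ge0// ltW.
Qed.

Lemma tnorm_orbit_diff (a : TT) (i j : nat) :
  tnorm (a *+ i - a *+ j) = tnorm (a *+ `|i%:Z - j%:Z|%N).
Proof. by rewrite -tnormMz mulrzBr. Qed.

Lemma badly_separated C (a : TT) N (delta : R) i j : badly_approximable C a ->
  0 <= delta -> N%:R * delta ^+ d <= C -> i != j ->
  (`|i%:Z - j%:Z| <= N)%N -> delta <= tnorm (a *+ i - a *+ j).
Proof.
move=> [C0 h] delta0 dC ij; rewrite tnorm_orbit_diff; set n := `|_|%N => nN.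
have n0 : (0 < n)%N by exact: absz_sub_gt0.
have nR : 0 < n%:R :> R by rewrite ltr0n.
rewrite -(ler_pXn2r d_gt0) ?nnegrE ?tnorm_ge0// -(ler_pM2l nR).
apply: le_trans (h n n0); apply: le_trans dC.
by rewrite ler_wpM2r ?exprn_ge0// ler_nat.
Qed.

Lemma badly_le1 C (a : TT) : badly_approximable C a -> C <= 1.
Proof.
move=> [_ /(_ 1%N isT)]; rewrite mul1r => /le_trans; apply.
by rewrite exprn_ile1 ?tnorm_ge0// (le_trans (tnorm_le_half _))//; lra.
Qed.

End return_times.

(** * Counting returns and density of orbits *)

Section orbits.
Context {R : realType} {d : nat}.
Local Notation TT := (torus R d).
Hypothesis d_gt0 : (0 < d)%N.
Variable nu : {finite_measure set (borel TT) -> \bar R}.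
Hypothesis nuh : ball_homogeneous nu.
Hypothesis mass_gt0 : 0 < mass nu.

(** At the separation scale [delta] of the first [N] orbit points, a ball still
    has volume at least a constant times [1 / N]. *)
Lemma ballvol_separation (C delta : R) N : (0 < N)%N -> 0 < delta -> delta <= 2 ->
  N%:R * delta ^+ d = C ->
  C / 4 ^+ d / N%:R * mass nu <= ballvol nu (delta / 2).
Proof.
move=> N0 delta0 delta2 dC.
have N0' : N%:R != 0 :> R by rewrite pnatr_eq0 -lt0n.
apply: le_trans (ballvol_lower nuh _ _); try lra.
rewrite -dC (_ : delta / 2 / 2 = delta / 4); last by field.
rewrite expr_div_n ler_wpM2r ?(ltW mass_gt0)// le_eqVlt; apply/orP; left; apply/eqP.
by field; rewrite N0' /= expf_neq0//; lra.
Qed.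

(** The bound carries no additive error term: as soon as one return [l] has norm
    below [2 r], the separation [delta] is below [2 r] as well, and the ball of
    radius [3 r] contains the disjoint balls of radius [delta / 2] about all
    the returns, each of volume of order [1 / N]. *)
Lemma orbit_count C (a : TT) : badly_approximable C a ->
  exists2 A : R, 0 < A & forall N (r : R), 0 < r ->
    #|[pred l : 'I_N | tnorm (a *+ l.+1) < 2 * r]|%:R <= A * N%:R * ballvol nu r.
Proof.
move=> bad; have [C0 h] := bad.
have c40 : 0 < 4 ^+ d :> R by exact: exprn_gt0.
have c240 : 0 < 24 ^+ d :> R by exact: exprn_gt0.
pose K := C / 4 ^+ d * mass nu.
have K0 : 0 < K by rewrite mulr_gt0// divr_gt0.
have A0 : 0 < 24 ^+ d / K by rewrite divr_gt0.
exists (24 ^+ d / K) => // N r r0.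
set P := [pred _ | _].
have [[l Pl]|noP] := pselect (exists l, P l); last first.
  rewrite (eq_card0 (A := P)) => [|l]; last by apply/negP => ?; apply: noP; exists l.
  by rewrite mulr_ge0 ?ballvol_ge0// mulr_ge0// ltW.
have N0 : (0 < N)%N by case: N {P Pl} l => // -[].
have N0' : 0 < N%:R :> R by rewrite ltr0n.
have [delta delta0 deltaC] := exists_root d_gt0 (divr_gt0 C0 N0').
have dC : N%:R * delta ^+ d = C by rewrite deltaC mulrCA mulfV ?mulr1// gt_eqF.
have sep (i j : nat) : i != j -> (`|i%:Z - j%:Z| <= N)%N ->
    delta <= tnorm (a *+ i - a *+ j).
  by move=> ij ijN; apply: (badly_separated d_gt0 bad (ltW delta0) _ ij ijN); rewrite dC.
have dl : delta <= tnorm (a *+ l.+1).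
  rewrite -(subr0 (a *+ l.+1)) -(mulr0n a); apply: sep => //.
  by rewrite subr0 absz_nat.
have d2r : delta < 2 * r by apply: le_lt_trans dl _; exact: Pl.
have d2 : delta <= 2 by rewrite (le_trans dl)// (le_trans (tnorm_le_half _))//; lra.
have := @packing _ _ nu nuh _ P (fun l : 'I_N => a *+ l.+1) delta (ball (0 : TT) (3 * r)).
move=> /(_ (measurable_ball _ _)) pk.
have {pk}: #|P|%:R * ballvol nu (delta / 2) <= ballvol nu (3 * r).
  apply: pk => [i j _ _ ij|i Pi y].
    apply: sep; first by rewrite eqSS.
    by rewrite subz_SS ltnW// absz_sub_lt.
  rewrite !ballE sub0r tnormN => iy.
  have -> : y = a *+ i.+1 - (a *+ i.+1 - y) by rewrite opprB addrC subrK.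
  apply: le_lt_trans (tnormD _ _) _; rewrite tnormN.
  by have : tnorm (a *+ i.+1) < 2 * r := Pi; lra.
move/le_trans/(_ (ballvol_triple nuh r0)).
have /(ler_wpM2l (ler0n R #|P|)) := ballvol_separation N0 delta0 d2 dC.
move=> /le_trans h1 /h1 {h1}.
rewrite mulrAC -/K mulrA ler_pdivrMr// -ler_pdivlMr// => /le_trans; apply.
rewrite le_eqVlt; apply/orP; left; apply/eqP.
by field; rewrite gt_eqF.
Qed.

Lemma packing_bound (I : finType) (c : I -> TT) (delta : R) :
  (forall i j, i != j -> delta <= tnorm (c i - c j)) ->
  #|I|%:R * ballvol nu (delta / 2) <= mass nu.
Proof.
move=> sep; apply: (@packing _ _ nu nuh I predT c) => // i j _ _; exact: sep.
Qed.

(** Otherwise the orbit would be [e]-separated and overfill the torus. *)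
Lemma orbit_recurrent (a : TT) (e : R) : 0 < e ->
  exists2 n, (0 < n)%N & tnorm (a *+ n) < e.
Proof.
move=> e0; apply: contrapT => no.
have e2 : 0 < e / 2 by rewrite divr_gt0.
have v0 : 0 < ballvol nu (e / 2) by exact: ballvol_gt0.
have m0 : 0 <= mass nu / ballvol nu (e / 2) by rewrite divr_ge0// ltW.
have /andP[_] := truncn_itv m0; set N := Num.truncn _.
rewrite ltr_pdivrMr// ltNge => /negP; apply.
have := @packing_bound 'I_N.+1 (fun i => a *+ i) e; rewrite card_ord; apply.
move=> i j ij; rewrite leNgt; apply/negP; rewrite tnorm_orbit_diff => ije.
apply: no; exists `|i%:Z - j%:Z|%N => //.
exact: absz_sub_gt0.
Qed.

(** Write [y = J! x].  The points [i x + n a] with [i <= J] and [n < N] are too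
    many to be [delta]-separated, whereas those with the same [i] are.  Hence
    some [(i - j) x], with [0 < |i - j| <= J], is [delta]-close to a multiple of
    [a].  As [i - j] divides [J!], the point [y] is [J! delta]-close to such a
    multiple, where [J] does not depend on [N] and [delta] tends to 0. *)
Lemma orbit_dense C (a y : TT) (e : R) : badly_approximable C a -> 0 < e ->
  exists k : int, tnorm (y - a *~ k) < e.
Proof.
move=> bad e0; have [C0 _] := bad.
have c40 : 0 < 4 ^+ d :> R by exact: exprn_gt0.
pose J := Num.truncn (4 ^+ d / C).
have JC : 1 < J.+1%:R * (C / 4 ^+ d).
  have /andP[_] := truncn_itv (ltW (divr_gt0 c40 C0)).
  by rewrite ltr_pdivrMr// mulrA ltr_pdivlMr// mul1r.
have [x xy] := torus_divisible y (fact_gt0 J).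
have J0 : 0 < J`!%:R :> R by rewrite ltr0n fact_gt0.
have eJ0 : 0 < (e / J`!%:R) ^+ d by rewrite exprn_gt0// divr_gt0.
pose N := (Num.truncn (C / (e / J`!%:R) ^+ d)).+1.
have NC : C < N%:R * (e / J`!%:R) ^+ d.
  have /andP[_] := truncn_itv (ltW (divr_gt0 C0 eJ0)).
  by rewrite ltr_pdivrMr.
have N0 : 0 < N%:R :> R by rewrite ltr0n.
have [delta delta0 deltaC] := exists_root d_gt0 (divr_gt0 C0 N0).
have dC : N%:R * delta ^+ d = C by rewrite deltaC mulrCA mulfV ?mulr1// gt_eqF.
have de : J`!%:R * delta < e.
  rewrite mulrC -ltr_pdivlMr// -(ltr_pXn2r d_gt0) ?nnegrE ?divr_ge0 ?ltW//.
  by rewrite -(ltr_pM2l N0) dC.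
have d1 : delta <= 1.
  rewrite -(ler_pXn2r d_gt0) ?nnegrE ?ler01 ?(ltW delta0)// expr1n -(ler_pM2l N0).
  by rewrite dC mulr1 (le_trans (badly_le1 bad))// ler1n.
have : ~ (J.+1 * N)%:R * ballvol nu (delta / 2) <= mass nu.
  apply/negP; rewrite -ltNge natrM.
  have d2 : delta <= 2 by lra.
  have /(ler_wpM2l (ltW (mulr_gt0 (ltr0Sn R J) N0))) :=
    @ballvol_separation C delta N isT delta0 d2 dC.
  apply: lt_le_trans; rewrite [ltRHS](_ : _ = J.+1%:R * (C / 4 ^+ d) * mass nu).
    by rewrite ltr_pMl.
  by field; rewrite !gt_eqF.
move=> pk.
have [[i n] [[j m] [ijnm]]] : exists u v : 'I_J.+1 * 'I_N, u != v /\
    tnorm ((x *+ u.1 + a *+ u.2) - (x *+ v.1 + a *+ v.2)) < delta.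
  apply: contrapT => no; apply: pk.
  have := @packing_bound ('I_J.+1 * 'I_N)%type (fun u => x *+ u.1 + a *+ u.2) delta.
  rewrite card_prod !card_ord; apply => u v uv; rewrite leNgt; apply/negP => duv.
  by apply: no; exists u, v.
rewrite /= opprD addrACA => dlt.
have ij : i != j.
  apply: contraTneq dlt => ij; rewrite -leNgt ij subrr add0r.
  apply: (badly_separated d_gt0 bad (ltW delta0) _ _ (_ : (_ <= N)%N)).
  - by rewrite dC.
  - by apply: contraNneq ijnm => nm; rewrite ij (val_inj nm).
  - by rewrite ltnW// absz_sub_lt.
(* multiplying by [t = J! / |i - j|] turns [(i - j) x] into [y] or [- y] *)
pose q := (i%:Z - j%:Z); pose k := (m%:Z - n%:Z).
have q0 : (0 < `|q|)%N by exact: absz_sub_gt0.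
have qJ : (`|q| <= J)%N by rewrite -ltnS absz_sub_lt.
have /dvdnP[t tJ] : (`|q| %| J`!)%N by apply: dvdn_fact; rewrite q0.
have dq : tnorm (x *~ q - a *~ k) < delta.
  by rewrite /q /k !mulrzBr opprB -!pmulrn.
have tle : (t <= J`!)%N by rewrite tJ leq_pmulr.
have dt : tnorm ((x *~ q - a *~ k) *+ t) < e.
  apply: le_lt_trans (tnormMn _ _) _; apply: le_lt_trans de.
  by apply: ler_pM; rewrite ?tnorm_ge0 ?ler_nat// ltW.
have E : (x *~ q - a *~ k) *+ t = x *~ (q * t%:Z) - a *~ (k * t%:Z).
  by rewrite mulrnBl !mulrzA -!pmulrn.
have [qge|qlt] := leP 0 q.
  exists (k * t%:Z); rewrite -xy pmulrn (_ : Posz J`! = q * t%:Z) -?E//.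
  by rewrite tJ PoszM gez0_abs// mulrC.
exists (- (k * t%:Z)); rewrite -xy pmulrn (_ : Posz J`! = - (q * t%:Z)).
  by rewrite -tnormN !mulrNz opprD !opprK -E.
by rewrite tJ PoszM ltz0_abs// mulrC mulNr.
Qed.

End orbits.

(** * Quasi-independence of shrinking targets *)

Section sums.
Context {R : realType}.

(** Summation by parts: decreasing weights preserve the sign of partial sums. *)
Lemma abel_sum (u v : nat -> R) : (forall n, 0 <= v n.+1 <= v n) ->
  (forall n, 0 <= \sum_(l < n) u l) ->
  forall n, 0 <= \sum_(l < n) u l * v l.
Proof.
move=> vd u0 n.
suff h : (\sum_(l < n) u l) * v n <= \sum_(l < n) u l * v l.
  apply: le_trans h; rewrite mulr_ge0//; case: n => [|n].
    by case/andP: (vd 0%N) => /le_trans h /h.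
  by case/andP: (vd n).
elim: n => [|n IH]; first by rewrite !big_ord0 mul0r.
have /andP[_ vn] := vd n.
apply: le_trans (ler_wpM2l (u0 n.+1) vn) _.
by rewrite !big_ord_recr /= mulrDl lerD2r.
Qed.

End sums.

Lemma measure_union_lower {R : realType} dd (T : measurableType dd)
    (nu : {finite_measure set T -> \bar R}) (I : finType) (A : set T)
    (B : I -> set T) : measurable A -> (forall i, measurable (B i)) ->
  fine (nu A) + fine (nu (\bigcup_i B i)) -
    \sum_i fine (nu (A `&` B i)) <= fine (nu (A `|` \bigcup_i B i)).
Proof.
move=> mA mB.
have mU : measurable (\bigcup_i B i).
  by apply: fin_bigcup_measurable => //; exact: finite_finset.
have mAB i : measurable (A `&` B i) by exact: measurableI.
have mI : measurable (A `&` \bigcup_i B i) by exact: measurableI.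
have h : fine (nu (A `&` \bigcup_i B i)) <= \sum_i fine (nu (A `&` B i)).
  by apply: fine_sub_sum => //; rewrite setI_bigcupr.
move: (\bigcup_i B i) mU mI h => U mU mI h.
have mD : measurable (A `\` U) by exact: measurableD.
have -> : A `|` U = (A `\` U) `|` U.
  apply/seteqP; split=> x /=; last by tauto.
  by have [] := pselect (U x); tauto.
have disj : (A `\` U) `&` U = set0.
  by apply/seteqP; split=> x //= -[[]].
rewrite measureU// fineD ?fin_num_measure//.
have -> : fine (nu A) = fine (nu (A `\` U)) + fine (nu (A `&` U)).
  rewrite -fineD ?fin_num_measure// -measureU//.
    congr (fine (nu _)); apply/seteqP; split=> x /=; last by tauto.
    by have [] := pselect (U x); tauto.
  by apply/seteqP; split=> x //= -[[_ ?] []].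
move: h; lra.
Qed.

Section quasi_independence.
Context {R : realType} {d : nat}.
Local Notation TT := (torus R d).
Hypothesis d_gt0 : (0 < d)%N.
Variable nu : {finite_measure set (borel TT) -> \bar R}.
Hypothesis nuh : ball_homogeneous nu.
Hypothesis mass_gt0 : 0 < mass nu.

(** By induction on [N], detaching the ball [E] of index 0.  A later ball meets
    [E] only if its index is the time of a return of norm below [2 r 0]; by
    [orbit_count] and summation by parts, the later balls that do have total
    volume at most [A * ballvol (r 0) * S], with [S] the sum over all later
    balls, and this is absorbed by the cross term of the square. *)
Lemma orbit_union_lower C (a : TT) : badly_approximable C a ->
  exists2 A : R, 0 < A & forall N (x0 : TT) (r : nat -> R),
    (forall n, 0 <= r n.+1 <= r n) ->
    \sum_(n < N) ballvol nu (r n) - A * (\sum_(n < N) ballvol nu (r n)) ^+ 2 <=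
    fine (nu (\bigcup_(n : 'I_N) ball (x0 - a *+ n) (r n))).
Proof.
move=> bad; have [A A0 count] := orbit_count d_gt0 nuh mass_gt0 bad.
exists A => //; elim=> [|N IH] x0 r rd.
  by rewrite !big_ord0 expr0n mulr0 subr0 fine_measure_ge0.
rewrite !big_ord_recl /=; set v0 := ballvol nu (r 0%N).
under eq_bigr do rewrite /bump add1n.
set S := \sum_(i < N) _.
have v00 : 0 <= v0 by exact: ballvol_ge0.
have S0 : 0 <= S by apply: sumr_ge0 => i _; exact: ballvol_ge0.
pose B (i : 'I_N) := ball (x0 - a - a *+ i) (r i.+1).
have -> : \bigcup_(n : 'I_N.+1) ball (x0 - a *+ n) (r n) =
    ball x0 (r 0%N) `|` \bigcup_i B i.
  apply/seteqP; split=> [y [n _]|y [h|[n _ h]]].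
  - have [j ->|->] := unliftP ord0 n; last by rewrite mulr0n subr0; left.
    rewrite /= /bump add1n => h; right; exists j => //.
    by rewrite /B -addrA -opprD -mulrS.
  - by exists ord0 => //; rewrite mulr0n subr0.
  - by exists (lift ord0 n) => //; rewrite /= /bump add1n mulrS opprD addrA.
have mB i : measurable (B i : set (borel TT)) by exact: measurable_ball.
have hB := measure_union_lower nu (measurable_ball x0 (r 0%N)) mB.
rewrite (ballvolE nuh) /= -/v0 in hB; apply: le_trans hB.
have hU := IH (x0 - a) (fun n => r n.+1) (fun n => rd n.+1).
rewrite -/S -/B in hU.
suff hI : \sum_i fine (nu (ball x0 (r 0%N) `&` B i)) <= A * v0 * S.
  have h1 : 0 <= A * v0 ^+ 2 by rewrite mulr_ge0 ?exprn_ge0// ltW.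
  have h2 : 0 <= A * v0 * S by rewrite mulr_ge0// mulr_ge0// ltW.
  move: hU hI h1 h2; rewrite !expr2; lra.
pose b (l : nat) : R := (tnorm (a *+ l.+1) < 2 * r 0%N)%R%:R.
have r0ge n : 0 <= r n <= r 0%N.
  elim: n => [|n /andP[IH1 IH2]]; first by have := rd 0%N; lra.
  by have := rd n; lra.
apply: (@le_trans _ _ (\sum_(i < N) b i * ballvol nu (r i.+1))).
  apply: ler_sum => i _; rewrite /b; have [h|h] := ltP; rewrite ?mul1r ?mul0r.
    rewrite -[leRHS](_ : fine (nu (B i)) = _); last by rewrite (ballvolE nuh).
    apply: fine_measure_le; [|exact: mB|exact: subIsetr].
    by apply: measurableI; exact: measurable_ball.
  rewrite (_ : _ `&` _ = set0) ?measure0//; apply/seteqP; split=> // y [].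
  rewrite /B !ballE => h1 h2.
  have := tnormD (x0 - y) (- (x0 - a - a *+ i - y)); rewrite tnormN.
  have -> : x0 - y + - (x0 - a - a *+ i - y) = a *+ i.+1.
    by rewrite -[x0 - a - _]addrA -opprD -mulrS [x0 - _ - y]addrAC subKr.
  by have := r0ge i.+1; lra.
have [r0|r0] := leP (r 0%N) 0.
  rewrite big1 => [|i _]; first by rewrite mulr_ge0// mulr_ge0// ltW.
  by rewrite /b ltNge (le_trans _ (tnorm_ge0 _)) ?mul0r//; lra.
rewrite -subr_ge0 [A * v0 * S]mulr_sumr -sumrB.
under eq_bigr do rewrite -mulrBl.
apply: (@abel_sum _ (fun l => A * v0 - b l) (fun l => ballvol nu (r l.+1))) => n.
  have /andP[_ rn] := rd n.+1.
  by rewrite ballvol_ge0 le_ballvol.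
rewrite sumrB sumr_const card_ord -mulr_natr subr_ge0.
apply: le_trans (le_trans (count n _ r0) _); last by rewrite mulrAC.
rewrite -sum1_card natr_sum [leRHS]big_mkcond/=; apply: ler_sum => i _.
by rewrite /b inE; case: ifP.
Qed.

(** The bound [eta] depends neither on [x0] nor on [r], hence holds for every
    tail of a given sequence. *)
Lemma orbit_union_positive C (a : TT) : badly_approximable C a ->
  exists2 eta : R, 0 < eta & forall (x0 : TT) (r : nat -> R),
    (forall n, 0 <= r n.+1 <= r n) ->
    (forall b, exists N, b <= \sum_(n < N) ballvol nu (r n)) ->
    exists N, eta <= fine (nu (\bigcup_(n : 'I_N) ball (x0 - a *+ n) (r n))).
Proof.
move=> bad; have [A A0 low] := orbit_union_lower bad.
pose e := (4 * A)^-1; have e0 : 0 < e by rewrite invr_gt0 mulr_gt0.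
have Ae : A * e = 4^-1 by rewrite /e; field; rewrite gt_eqF.
exists (e / 2) => [|x0 r rd div]; first by rewrite divr_gt0.
have ex : exists N, e <= \sum_(n < N) ballvol nu (r n) by exact: div.
(* For the first [N] with [S >= e], either the last ball alone has volume at
   least [e], or [S < 2 e] and then [S - A S^2 >= S / 2]. *)
have [N eN Nmin] := ex_minnP ex; exists N.
have := low N x0 r rd; case: N eN Nmin => [|N] eN Nmin.
  by move: eN; rewrite big_ord0 leNgt e0.
have SN : \sum_(n < N) ballvol nu (r n) < e.
  by rewrite ltNge; apply/negP => /Nmin; rewrite ltnn.
move: eN; rewrite big_ord_recr /=; set S := \sum_(n < N) _ in SN *.
set v := ballvol nu (r N) => eN.
have S0 : 0 <= S by apply: sumr_ge0 => i _; exact: ballvol_ge0.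
have [ev _|ve] := leP e v.
  apply: (@le_trans _ _ v); first lra.
  rewrite -[leLHS](_ : fine (nu (ball (x0 - a *+ N) (r N))) = _).
    apply: fine_measure_le; first exact: measurable_ball.
      by apply: fin_bigcup_measurable => // *; exact: measurable_ball.
    exact: (@bigcup_sup _ _ (ord_max : 'I_N.+1) setT
      (fun n => ball (x0 - a *+ n) (r n))).
  by rewrite (ballvolE nuh).
apply: le_trans; have : A * (S + v) <= 2^-1.
  have : A * (S + v) <= A * (2 * e) by rewrite ler_pM2l//; lra.
  by rewrite mulrCA Ae; lra.
move=> /(ler_wpM2r (_ : 0 <= S + v)); rewrite expr2 mulrA; lra.
Qed.

End quasi_independence.

(** * Series, limsup sets and translations *)

Section series.
Context {R : realType}.

Lemma nneseries_pinftyP (u : nat -> R) : (forall n, 0 <= u n) ->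
  (\sum_(n <oo) (u n)%:E = +oo)%E <->
  forall b, exists N, b <= \sum_(n < N) u n.
Proof.
move=> u0; have cv : cvgn (fun N => \sum_(0 <= n < N) (u n)%:E)%E.
  by apply: is_cvg_nneseries => n _ _; rewrite lee_fin.
split=> [uoo b|h].
  apply: contrapT => no.
  have : (\sum_(n <oo) (u n)%:E <= b%:E)%E.
    apply: lime_le => //; apply: nearW => N; rewrite sumEFin lee_fin big_mkord.
    by rewrite leNgt; apply/negP => bN; apply: no; exists N; exact: ltW.
  by rewrite uoo.
apply/eqyP => b b0; have [N bN] := h b.
apply: le_trans (nneseries_lim_ge N _); last by move=> n _; rewrite lee_fin.
by rewrite sumEFin lee_fin big_mkord.
Qed.

End series.

Lemma lim_sup_set_lower {R : realType} dd (T : measurableType dd)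
    (nu : {finite_measure set T -> \bar R}) (E : (set T)^nat) (eta : R) :
  (forall n, measurable (E n)) ->
  (forall M, exists N, eta <= fine (nu (\bigcup_(n : 'I_N) E (M + n)%N))) ->
  eta <= fine (nu (lim_sup_set E)).
Proof.
move=> mE h.
have mT k : measurable (\bigcup_(j >= k) E j) by exact: bigcup_measurable.
have mL : measurable (lim_sup_set E) by exact: bigcap_measurable.
have cv : nu (\bigcup_(k >= n) E k) @[n --> \oo] --> nu (lim_sup_set E).
  apply: lim_sup_set_cvg => //.
  by rewrite -ge0_fin_numE// fin_num_measure.
rewrite -lee_fin fineK ?fin_num_measure//.
rewrite -(cvg_lim _ cv)//; apply: lime_ge.
  by apply/cvg_ex; exists (nu (lim_sup_set E)).
apply: nearW => M; have [N hN] := h M.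
rewrite -[leRHS]fineK ?fin_num_measure// lee_fin (le_trans hN)//.
apply: fine_measure_le => //.
  by apply: fin_bigcup_measurable => //; exact: finite_finset.
by move=> x [n _ En]; exists (M + n)%N => //=; rewrite leq_addr.
Qed.

Section translations.
Context {R : realType} {d : nat}.
Local Notation TT := (torus R d).

Lemma iter_translation (alpha : 'rV[R]_d) n (x : TT) :
  iter n (translation alpha) x = x + toT alpha *+ n.
Proof.
elim: n => [|n IH]; first by rewrite mulr0n addr0.
by rewrite iterS IH /translation mulrSr addrA.
Qed.

Lemma preimage_translation_ball (alpha : 'rV[R]_d) n (x0 : TT) r :
  iter n (translation alpha) @^-1` ball x0 r = ball (x0 - toT alpha *+ n) r.
Proof.
apply/seteqP; split=> x; rewrite /= !ballE iter_translation opprD addrA;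
  by rewrite addrAC.
Qed.

Lemma Haar_ball_homogeneous (mu : probability (borel TT) R) :
  is_Haar mu -> ball_homogeneous mu.
Proof.
move=> Hmu x y r; apply: etrans _ (Hmu (y - x) _ (measurable_ball y r)).
congr (mu _); apply/seteqP.
have e z : y - (y - x + z) = x - z by rewrite opprD addrA subKr.
by split=> z; rewrite /= !ballE e.
Qed.

Lemma mass_probability (mu : probability (borel TT) R) : mass mu = 1.
Proof. exact: (congr1 fine (probability_setT mu)). Qed.

End translations.

(** * Constant type implies full measure *)

Section orbit_invariant_measures.
Context {R : realType} {d : nat}.
Local Notation TT := (torus R d).
Hypothesis d_gt0 : (0 < d)%N.
Variable mu : {finite_measure set (borel TT) -> \bar R}.
Hypothesis muh : ball_homogeneous mu.
Hypothesis mass_mu : 0 < mass mu.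

(** Invariance gives the equality of masses along an orbit.  A ball about an
    arbitrary [y] is the increasing union of the balls of smaller radii about
    [y], each of which is contained in a ball of the original radius about a
    point of the orbit of [x]. *)
Lemma dense_orbit_homogeneous (nu : {finite_measure set (borel TT) -> \bar R})
    C (a : TT) : badly_approximable C a ->
  (forall (x : TT) r, nu (ball x r) = nu (ball (x + a) r)) -> ball_homogeneous nu.
Proof.
move=> bad inv.
have invn (x : TT) r n : nu (ball x r) = nu (ball (x + a *+ n) r).
  by elim: n => [|n ->]; rewrite ?mulr0n ?addr0// inv mulrSr addrA.
have invz (x : TT) r (k : int) : nu (ball x r) = nu (ball (x + a *~ k) r).
  case: k => n; first exact: invn.
  by rewrite [RHS](invn _ _ n.+1) NegzE mulrNz subrK.
suff le (x y : TT) r : (nu (ball y r) <= nu (ball x r))%E.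
  by move=> x y r; apply/eqP; rewrite eq_le !le.
pose F : (set TT)^nat := fun n => ball y (r - n.+1%:R^-1).
have mF n : measurable (F n : set (borel TT)) by exact: measurable_ball.
have FU : ball y r = \bigcup_n F n.
  apply/seteqP; split=> [z|z [n _]]; rewrite /F !ballE; last first.
    by move=> h; apply: lt_trans h _; rewrite ltrBlDr ltrDl invr_gt0.
  move=> yz; have [n] := ltr_add_invr yz.
  by exists n => //; rewrite /F ballE ltrBrDr.
have mU : measurable (\bigcup_n F n : set (borel TT)) by exact: bigcup_measurable.
have ndF : nondecreasing_seq F.
  apply/nondecreasing_seqP => n; apply/subsetPset; apply: le_ball.
  by rewrite lerB// lef_pV2 ?posrE// ler_nat.
rewrite FU -(cvg_lim _ (nondecreasing_cvg_mu mF mU ndF))//.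
apply: lime_le.
  by apply/cvg_ex; eexists; exact: (nondecreasing_cvg_mu mF mU ndF).
apply: nearW => n /=.
have n0 : 0 < n.+1%:R^-1 :> R by rewrite invr_gt0.
have [k hk] := orbit_dense d_gt0 muh mass_mu (y - x) bad n0.
rewrite (invz x r k); apply: le_measure; rewrite ?inE//; first exact: measurable_ball.
move=> z; rewrite /F !ballE => yz.
have -> : x + a *~ k - z = - (y - x - a *~ k) + (y - z).
  by rewrite -[y - x - _]addrA -opprD opprB subrKA.
apply: le_lt_trans (tnormD _ _) _; rewrite tnormN.
by have := ltrD hk yz; rewrite addrCA subrr addr0.
Qed.

(** Both volumes are of order [r ^ d], so a series of volumes that diverges for
    [mu] also diverges for [nu]. *)
Lemma ballvol_compare (nu : {finite_measure set (borel TT) -> \bar R}) r :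
  ball_homogeneous nu -> 0 < mass nu -> 0 <= r ->
  mass nu / (8 ^+ d * mass mu) * ballvol mu r <= ballvol nu r.
Proof.
move=> nuh nu0; rewrite le_eqVlt => /orP[/eqP <-|r0].
  rewrite (_ : ballvol mu 0 = 0) ?mulr0 ?ballvol_ge0// /ballvol.
  rewrite (_ : ball _ _ = set0) ?measure0//.
  by apply/seteqP; split=> x //; rewrite ballE ltNge tnorm_ge0.
have c0 : 0 < 8 ^+ d :> R by exact: exprn_gt0.
have k0 : 0 <= mass nu / (8 ^+ d * mass mu) by rewrite divr_ge0 ?mulr_ge0// ltW.
have e x : mass nu / (8 ^+ d * mass mu) * (x ^+ d * mass mu) = (x / 8) ^+ d * mass nu.
  by rewrite expr_div_n; field; rewrite !gt_eqF.
have [r1|r1] := leP r 1.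
  apply: le_trans (ler_wpM2l k0 (ballvol_upper muh r0)) _.
  rewrite e (_ : 4 * r / 8 = r / 2); last by field.
  exact: ballvol_lower.
apply: le_trans (le_ballvol nu (ltW r1)).
apply: le_trans (ballvol_lower nuh ltr01 (lexx 1)).
apply: le_trans (ler_wpM2l k0 (ballvol_le_mass mu r)) _.
have := e 1; rewrite expr1n mul1r => ->.
rewrite ler_wpM2r ?(ltW nu0)// lerXn2r ?nnegrE//; lra.
Qed.

Lemma tail_diverges (nu : {finite_measure set (borel TT) -> \bar R})
    (r : R^nat) (M : nat) (b : R) :
  ball_homogeneous nu -> 0 < mass nu -> (forall n, 0 <= r n) ->
  (forall c, exists N, c <= \sum_(n < N) ballvol mu (r n)) ->
  exists N, b <= \sum_(n < N) ballvol nu (r (M + n)%N).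
Proof.
move=> nuh mass_nu r0 div.
have c0 : 0 < 8 ^+ d :> R by exact: exprn_gt0.
have k0 : 0 < mass nu / (8 ^+ d * mass mu) by rewrite divr_gt0// mulr_gt0.
have [N hN] := div (b / (mass nu / (8 ^+ d * mass mu)) + \sum_(n < M) ballvol mu (r n)).
have sE p q : \sum_(n < p) ballvol mu (r n) + \sum_(n < q) ballvol mu (r (p + n)%N) =
    \sum_(n < p + q) ballvol mu (r n).
  by rewrite big_split_ord.
exists N; apply: (@le_trans _ _ (mass nu / (8 ^+ d * mass mu) *
    \sum_(n < N) ballvol mu (r (M + n)%N))).
  rewrite -ler_pdivrMl// mulrC -(lerD2r (\sum_(n < M) ballvol mu (r n))).
  apply: le_trans hN _; rewrite [leRHS]addrC sE addnC -sE lerDl.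
  by apply: sumr_ge0 => n _; exact: ballvol_ge0.
by rewrite mulr_sumr; apply: ler_sum => n _; exact: ballvol_compare.
Qed.

Lemma lim_sup_orbit_gt0 (nu : {finite_measure set (borel TT) -> \bar R})
    C (a x0 : TT) (r : R^nat) : badly_approximable C a ->
  ball_homogeneous nu -> 0 < mass nu -> (forall n, 0 <= r n.+1 <= r n) ->
  (forall c, exists N, c <= \sum_(n < N) ballvol mu (r n)) ->
  0 < fine (nu (lim_sup_set (fun n => ball (x0 - a *+ n) (r n)))).
Proof.
move=> bad nuh mass_nu rd div.
have [eta eta0 heta] := orbit_union_positive d_gt0 nuh mass_nu bad.
apply: lt_le_trans eta0 _; apply: lim_sup_set_lower => [n|M].
  exact: measurable_ball.
have [||N hN] := heta (x0 - a *+ M) (fun n => r (M + n)%N).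
- by move=> n; rewrite addnS; exact: rd.
- by move=> b; apply: tail_diverges => // n; have := rd n; lra.
exists N; apply: le_trans hN _; rewrite le_eqVlt; apply/orP; left; apply/eqP.
congr (fine (nu _)); apply: eq_bigcupr => n _.
by rewrite mulrnDr opprD addrA.
Qed.

End orbit_invariant_measures.

Lemma exists_restriction {R : realType} dd (S : measurableType dd)
    (mu : {finite_measure set S -> \bar R}) (W : set S) : measurable W ->
  exists nu : {finite_measure set S -> \bar R}, forall A, nu A = mu (A `&` W).
Proof.
move=> mW; have Woo : (mu W < +oo)%E by rewrite -ge0_fin_numE// fin_num_measure.
by exists (mfrestr mW Woo).
Qed.

Section constant_type_MSTP.
Context {R : realType} {d : nat}.
Local Notation TT := (torus R d).
Hypothesis d_gt0 : (0 < d)%N.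
Variables (alpha : 'rV[R]_d).
Local Notation T := (translation alpha).

Lemma measurable_translation (A : set TT) :
  measurable (A : set (borel TT)) -> measurable (T @^-1` A : set (borel TT)).
Proof.
have mT : measurable_fun setT (T : borel TT -> borel TT).
  apply: (@measurability _ _ (borel TT) (borel TT) setT T (@open TT)) => //.
  move=> _ [V oV <-]; rewrite setTI; apply: sub_gen_smallest; rewrite /= openE.
  move=> y Vy; have /nbhs_ballP[e /= e0 eV] : nbhs (T y) V by exact: open_nbhs_nbhs.
  apply/nbhs_ballP; exists e => // z; rewrite ballE => yz; apply: eV.
  by rewrite ballE /translation opprD addrACA subrr addr0.
by move=> mA; rewrite -[X in measurable X]setTI; exact: mT.
Qed.

Section invariant_measure.
Variable mu : {finite_measure set (borel TT) -> \bar R}.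
Hypothesis muh : ball_homogeneous mu.
Hypothesis mass_mu : 0 < mass mu.
Hypothesis muT : forall A : set TT, measurable (A : set (borel TT)) ->
  mu (T @^-1` A) = mu A.

(** Since [T^-1 W] is contained in [W], taking preimages can only increase the
    mass inside [W].  This holds for [A] and for its complement, whose masses
    inside [W] add up to that of [W], so neither increases. *)
Lemma restriction_invariant (A W : set TT) : measurable (A : set (borel TT)) ->
  measurable (W : set (borel TT)) -> T @^-1` W `<=` W ->
  mu (T @^-1` A `&` W) = mu (A `&` W).
Proof.
move=> mA mW TW.
have le (B : set TT) : measurable (B : set (borel TT)) ->
    fine (mu (B `&` W)) <= fine (mu (T @^-1` B `&` W)).
  move=> mB; have mBW : measurable (B `&` W : set (borel TT)) by exact: measurableI.
  rewrite -(muT mBW); apply: fine_measure_le.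
  - exact: measurable_translation.
  - by apply: measurableI => //; exact: measurable_translation.
  - by move=> x [Bx Wx]; split => //; exact: TW.
have split (B : set TT) : measurable (B : set (borel TT)) ->
    fine (mu W) = fine (mu (B `&` W)) + fine (mu (~` B `&` W)).
  move=> mB; have mC : measurable (~` B : set (borel TT)) by exact: measurableC.
  have mBW : measurable (B `&` W : set (borel TT)) by exact: measurableI.
  have mCW : measurable (~` B `&` W : set (borel TT)) by exact: measurableI.
  rewrite -fineD ?fin_num_measure// -measureU//.
    by rewrite -setIUl setUv setTI.
  by apply/seteqP; split=> x // -[[? _] []].
have mC : measurable (~` A : set (borel TT)) by exact: measurableC.
have mTA := measurable_translation mA.
have mTAW : measurable (T @^-1` A `&` W : set (borel TT)) by exact: measurableI.
have mAW : measurable (A `&` W : set (borel TT)) by exact: measurableI.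
rewrite -[LHS]fineK ?fin_num_measure// -[RHS]fineK ?fin_num_measure//.
congr (_%:E).
have := le _ mA; have := le _ mC; have := split _ mA; have := split _ mTA.
rewrite -preimage_setC; lra.
Qed.

(** Otherwise the restriction of [mu] to the complement of the limsup set would
    be ball homogeneous of positive mass, and so would charge the limsup set. *)
Lemma badly_lim_sup_full C (x0 : TT) (r : R^nat) : badly_approximable C (toT alpha) ->
  (forall n, 0 <= r n.+1 <= r n) ->
  (forall c, exists N, c <= \sum_(n < N) ballvol mu (r n)) ->
  mu (~` lim_sup_set (fun n => ball (x0 - toT alpha *+ n) (r n))) = 0%E.
Proof.
move=> bad rd div; set X := lim_sup_set _.
have mX : measurable (X : set (borel TT)).
  apply: bigcap_measurable => // k _; apply: bigcup_measurable => n _.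
  exact: measurable_ball.
have mW : measurable (~` X : set (borel TT)) by exact: measurableC.
apply: contrapT => /eqP W0.
(* a visit of [x] at time [m.+1] is a visit of [T x] at time [m], when the
   radius is at least as large *)
have TW : T @^-1` (~` X) `<=` ~` X.
  move=> x /= nX Xx; apply: nX => n _; have [m /= nm Em] := Xx n.+1 I.
  case: m nm Em => // m nm Em; exists m => //.
  move: Em; rewrite !ballE /translation => Em.
  have -> : x0 - toT alpha *+ m - (x + toT alpha) = x0 - toT alpha *+ m.+1 - x.
    by rewrite mulrSr !opprD !addrA addrAC.
  by apply: lt_le_trans Em _; have := rd m; lra.
have [nu nuE] := exists_restriction mu mW.
have nuh : ball_homogeneous nu.
  apply: (dense_orbit_homogeneous d_gt0 muh mass_mu bad) => x s.
  rewrite !nuE -(restriction_invariant (measurable_ball (x + toT alpha) s) mW TW).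
  by rewrite (preimage_translation_ball alpha 1) mulr1n addrK.
have mass_nu : 0 < mass nu.
  rewrite /mass nuE setTI fine_gt0// lt_neqAle eq_sym W0 measure_ge0/=.
  by rewrite -ge0_fin_numE// fin_num_measure.
have := lim_sup_orbit_gt0 d_gt0 muh mass_mu x0 bad nuh mass_nu rd div.
by rewrite nuE setICr measure0 ltxx.
Qed.

End invariant_measure.
End constant_type_MSTP.

(** * The Haar measure *)

Section Haar.
Context {R : realType} {d : nat}.
Local Notation TT := (torus R d).

Lemma Haar_finite_measure (mu : probability (borel TT) R) : is_Haar mu ->
  exists m : {finite_measure set (borel TT) -> \bar R},
    [/\ forall A, mu A = m A, ball_homogeneous m & mass m = 1].
Proof.
move=> Hmu; exists mu; split => //; first exact: Haar_ball_homogeneous.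
exact: mass_probability.
Qed.

Lemma Haar_translation (mu : probability (borel TT) R) (alpha : 'rV[R]_d)
    (A : set TT) : is_Haar mu -> measurable (A : set (borel TT)) ->
  mu (translation alpha @^-1` A) = mu A.
Proof.
move=> Hmu mA; rewrite -(Hmu (toT alpha) _ mA); congr (mu _).
by apply/seteqP; split=> x; rewrite /= /translation addrC.
Qed.

Lemma series_ballP (m : {finite_measure set (borel TT) -> \bar R}) (x0 : TT)
    (r : R^nat) : ball_homogeneous m ->
  (\sum_(n <oo) m (ball x0 (r n)) = +oo)%E <->
  forall c, exists N, c <= \sum_(n < N) ballvol m (r n).
Proof.
move=> mh.
have -> : (\sum_(n <oo) m (ball x0 (r n)) = \sum_(n <oo) (ballvol m (r n))%:E)%E.
  by apply: eq_eseriesr => n _; exact: (ballvolE mh x0).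
exact: (@nneseries_pinftyP R (fun n => ballvol m (r n)) (fun n => ballvol_ge0 m (r n))).
Qed.

Lemma badly_MSTP C (alpha : 'rV[R]_d) (mu : probability (borel TT) R) :
  (0 < d)%N -> is_Haar mu -> badly_approximable C (toT alpha) ->
  MSTP mu (translation alpha).
Proof.
move=> d_gt0 Hmu bad x0 r rd div.
split; [by move=> n; exact: measurable_ball|exact: div|].
have -> : (fun n => iter n (translation alpha) @^-1` ball x0 (r n)) =
    (fun n => ball (x0 - toT alpha *+ n) (r n)).
  by apply/funext => n; exact: preimage_translation_ball.
case: (Haar_finite_measure Hmu) => m [mE mh m1].
have mT (A : set TT) : measurable (A : set (borel TT)) ->
    m (translation alpha @^-1` A) = m A.
  by move=> mA; rewrite -!mE; exact: Haar_translation.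
have m0 : 0 < mass m by rewrite m1.
have div' : forall c, exists N, c <= \sum_(n < N) ballvol m (r n).
  by apply/(series_ballP x0 r mh); rewrite -div; apply: eq_eseriesr => n _.
have := badly_lim_sup_full d_gt0 mh m0 mT x0 bad rd div'.
rewrite -mE; set X := lim_sup_set _ => W0.
have mX : measurable (X : set (borel TT)).
  apply: bigcap_measurable => // k _; apply: bigcup_measurable => n _.
  exact: measurable_ball.
by have := probability_setC mu (measurableC mX); rewrite setCK W0 sube0.
Qed.

End Haar.

(** * Well approximable points and null limsup sets *)

Section blocks.
Context {R : realType}.

(** The last two clauses follow from the first and bound the block index [k n]
    from either side. *)
Lemma block_index (N : nat -> nat) : N 0%N = 0%N ->
  (forall j, (N j < N j.+1)%N) -> exists k : nat -> nat,
  [/\ forall n, (N (k n) <= n < N (k n).+1)%N,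
      forall n j, (N j <= n)%N -> (j <= k n)%N &
      forall n j, (n < N j.+1)%N -> (k n <= j)%N].
Proof.
move=> N0 NS.
have Nmono : {homo N : i j / (i <= j)%N}.
  by apply: homo_leq => //; [exact: leq_trans|move=> j; exact: ltnW].
have Nge j : (j <= N j)%N by elim: j => // j IH; exact: leq_ltn_trans (NS j).
have ex n : exists j, (n < N j.+1)%N by exists n; exact: Nge.
exists (fun n => ex_minn (ex n)).
have le n j : (n < N j.+1)%N -> (ex_minn (ex n) <= j)%N.
  by case: ex_minnP => k _; apply.
split=> // [n|n j].
  case: ex_minnP => -[|k] -> kmin; first by rewrite N0.
  by rewrite andbT leqNgt; apply/negP => /kmin; rewrite ltnn.
case: ex_minnP => k kn _ jn; rewrite leqNgt; apply/negP => kj.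
by have := leq_trans kn (leq_trans (Nmono _ _ kj) jn); rewrite ltnn.
Qed.

Lemma series_blocks (u : nat -> R) (N : nat -> nat) (c : R) : N 0%N = 0%N ->
  (forall j, (N j <= N j.+1)%N) -> 0 < c ->
  (forall j, c <= \sum_(N j <= n < N j.+1) u n) ->
  forall b, exists n, b <= \sum_(i < n) u i.
Proof.
move=> N0 NS c0 h b.
have sum j : j%:R * c <= \sum_(0 <= n < N j) u n.
  elim: j => [|j IH]; first by rewrite N0 mul0r big_geq.
  by rewrite (big_cat_nat (leq0n _) (NS j))/= -natr1 mulrDl mul1r lerD.
have [b0|b0] := leP b 0; first by exists 0%N; rewrite big_ord0.
have /andP[_] := truncn_itv (ltW (divr_gt0 b0 c0)).
rewrite ltr_pdivrMr// => hb; eexists; apply: le_trans (ltW hb) _.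
by apply: le_trans (sum _) _; rewrite big_mkord.
Qed.

End blocks.

Section well_approximable.
Context {R : realType} {d : nat}.
Local Notation TT := (torus R d).
Hypothesis d_gt0 : (0 < d)%N.
Variable nu : {finite_measure set (borel TT) -> \bar R}.
Hypothesis nuh : ball_homogeneous nu.
Hypothesis mass_gt0 : 0 < mass nu.
Variable a : TT.
Hypothesis not_badly : forall C, ~ badly_approximable C a.

Lemma well_approximable (C : R) : 0 < C ->
  exists2 n, (0 < n)%N & n%:R * tnorm (a *+ n) ^+ d < C.
Proof.
move=> C0; apply: contrapT => no; apply: (not_badly (C := C)); split=> // n n0.
by rewrite leNgt; apply/negP => h; apply: no; exists n.
Qed.

(** Let [N = K Q] with [K * tnorm (Q a) <= rho].  Writing [n = q Q + s] with
    [q < K] and [s < Q], the point [n a] is [rho]-close to [s a], so that [Q]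
    balls of radius [2 rho] contain the union; their total volume is of order
    [Q * rho ^ d = 1 / K]. *)
Lemma small_orbit_union (e : R) (M : nat) : 0 < e -> exists N,
  [/\ (M <= N)%N, (0 < N)%N & forall (x0 : TT) (rho : R), 0 < rho ->
     N%:R * rho ^+ d = 1 ->
     fine (nu (\bigcup_(n : 'I_N) ball (x0 - a *+ n) rho)) <= e].
Proof.
move=> e0.
pose L : R := 8 ^+ d * mass nu / e.
have L0 : 0 < L by rewrite divr_gt0// mulr_gt0// exprn_gt0.
pose K := (maxn M (Num.truncn L).+1).
have K0 : (0 < K)%N by rewrite leq_max orbT.
have KL : L <= K%:R.
  have /andP[_ /ltW h] := truncn_itv (ltW L0).
  by apply: le_trans h _; rewrite ler_nat leq_max leqnn orbT.
have KR : 0 < K%:R :> R by rewrite ltr0n.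
have KC : 0 < (K%:R ^+ d.+1)^-1 :> R by rewrite invr_gt0 exprn_gt0.
have [Q Q0 hQ] := well_approximable KC.
have QR : 0 < Q%:R :> R by rewrite ltr0n.
exists (K * Q)%N; split; first exact: leq_trans (leq_maxl M _) (leq_pmulr _ Q0).
  by rewrite muln_gt0 K0.
move=> x0 rho rho0 rhod.
have Kt : K%:R * tnorm (a *+ Q) <= rho.
  rewrite -(ler_pXn2r d_gt0) ?nnegrE ?(ltW rho0) ?mulr_ge0 ?tnorm_ge0//.
  rewrite -(ler_pM2l (mulr_gt0 KR QR)) -natrM rhod natrM exprMn.
  have -> : K%:R * Q%:R * (K%:R ^+ d * tnorm (a *+ Q) ^+ d) =
      K%:R ^+ d.+1 * (Q%:R * tnorm (a *+ Q) ^+ d) by rewrite exprS; ring.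
  by rewrite -ler_pdivlMl ?exprn_gt0// mulr1 ltW.
apply: (@le_trans _ _ (\sum_(s < Q) fine (nu (ball (x0 - a *+ s) (2 * rho))))).
  apply: fine_sub_sum => [s| |x [n _]]; first exact: measurable_ball.
    by apply: fin_bigcup_measurable => // *; exact: measurable_ball.
  rewrite ballE => nx; have sQ : (n %% Q < Q)%N by rewrite ltn_mod.
  exists (Ordinal sQ) => //; rewrite ballE /=.
  have qK : (n %/ Q <= K)%N by rewrite -ltnS ltn_divLR// mulSn ltn_addl// ltn_ord.
  have -> : x0 - a *+ (n %% Q) - x = (x0 - a *+ n - x) + a *+ Q *+ (n %/ Q).
    have -> : a *+ n = a *+ Q *+ (n %/ Q) + a *+ (n %% Q).
      by rewrite -mulrnA -mulrnDr [(Q * _)%N]mulnC -divn_eq.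
    by rewrite [a *+ Q *+ _ + _]addrC opprD addrA [_ - a *+ Q *+ _ - x]addrAC subrK.
  apply: le_lt_trans (tnormD _ _) _.
  have : tnorm (a *+ Q *+ (n %/ Q)) <= rho.
    apply: le_trans (tnormMn _ _) _; apply: le_trans Kt.
    by rewrite ler_wpM2r ?tnorm_ge0// ler_nat.
  by lra.
rewrite (eq_bigr (fun=> ballvol nu (2 * rho))) => [|s _]; last by rewrite (ballvolE nuh).
rewrite sumr_const card_ord -[leLHS]mulr_natl.
have r20 : 0 < 2 * rho by rewrite mulr_gt0.
apply: le_trans (ler_wpM2l (ler0n _ _) (ballvol_upper nuh r20)) _.
have KQ0 : K%:R * Q%:R != 0 :> R by rewrite mulf_neq0// gt_eqF.
have rhoE : rho ^+ d = (K%:R * Q%:R)^-1.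
  by apply: (mulfI KQ0); rewrite mulfV// -natrM.
have -> : 4 * (2 * rho) = 8 * rho by ring.
have -> : Q%:R * ((8 * rho) ^+ d * mass nu) = 8 ^+ d * mass nu / K%:R.
  by rewrite exprMn rhoE; field; rewrite !gt_eqF.
by rewrite ler_pdivrMr// [e * _]mulrC -ler_pdivrMr.
Qed.

(** On the block from [N j] to [N j.+1] the radius is [(N j.+1) ^ (-1/d)].
    As [N j.+1 > 2 * N j], the block contains at least half of the indices below
    [N j.+1], so it contributes a fixed amount to the series, whereas the union
    over all indices below [N j.+1] has measure at most [1 / 2 ^ j.+1]; these
    unions have a null limsup set. *)
Lemma null_orbit_target : exists r : R^nat,
  [/\ forall n, 0 <= r n.+1 <= r n,
      forall c, exists N, c <= \sum_(n < N) ballvol nu (r n) &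
      forall x0, nu (lim_sup_set (fun n => ball (x0 - a *+ n) (r n))) = 0%E].
Proof.
have e0 k : 0 < 1 / (2 ^ k.+1)%:R :> R by rewrite divr_gt0// ltr0n expn_gt0.
have /choice[f fP] : forall kM : nat * nat, exists N,
  [/\ (kM.2 <= N)%N, (0 < N)%N & forall (x0 : TT) (rho : R), 0 < rho ->
     N%:R * rho ^+ d = 1 ->
     fine (nu (\bigcup_(n : 'I_N) ball (x0 - a *+ n) rho)) <= 1 / (2 ^ kM.1.+1)%:R].
  by move=> [k M]; exact: small_orbit_union.
pose N := fix N k := if k is j.+1 then f (j, (2 * N j).+1) else 0%N.
have N2 j : (2 * N j < N j.+1)%N by have [] := fP (j, (2 * N j).+1).
have NS j : (N j < N j.+1)%N by apply: leq_ltn_trans (N2 j); rewrite leq_pmull.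
have Npos j : 0 < (N j.+1)%:R :> R by rewrite ltr0n (leq_ltn_trans _ (NS j)).
have /choice[rho rhoP] : forall j, exists rho : R, 0 < rho /\ (N j.+1)%:R * rho ^+ d = 1.
  move=> j; have Nj : 0 < (N j.+1)%:R^-1 :> R by rewrite invr_gt0.
  by have [y y0 yE] := exists_root d_gt0 Nj; exists y; rewrite yE mulfV ?gt_eqF.
have rho1 j : rho j <= 1.
  have [r0 rE] := rhoP j; rewrite -(ler_pXn2r d_gt0) ?nnegrE ?(ltW r0)// expr1n -rE.
  by rewrite ler_peMl ?exprn_ge0 ?(ltW r0)// ler1n -(ltr0n R).
have [k [kP kge kle]] := block_index (erefl : N 0%N = 0%N) NS.
have Nmono : {homo N : i j / (i <= j)%N}.
  by apply: homo_leq => //; [exact: leq_trans|move=> j; exact: ltnW].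
exists (rho \o k); split => [n|c|x0] /=.
- have [r0 rE] := rhoP (k n); have [r0' rE'] := rhoP (k n.+1).
  rewrite (ltW r0')/= -(ler_pXn2r d_gt0) ?nnegrE ?(ltW r0) ?(ltW r0')//.
  rewrite -(ler_pM2l (Npos (k n))) rE -[leRHS]rE' ler_wpM2r ?exprn_ge0 ?(ltW r0')//.
  rewrite ler_nat; apply: Nmono; rewrite ltnS; apply: kge.
  by have /andP[h _] := kP n; exact: leq_trans h _.
- apply: (@series_blocks _ (fun n => ballvol nu (rho (k n))) N
    ((2 ^+ d)^-1 * mass nu / 2) erefl) => [j||j].
  + exact: ltnW.
  + by rewrite divr_gt0// mulr_gt0// invr_gt0 exprn_gt0.
  rewrite (eq_big_nat _ _ (F2 := fun=> ballvol nu (rho j))); last first.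
    move=> n /andP[n1 n2]; congr (ballvol nu (rho _)).
    by apply/eqP; rewrite eqn_leq kge// kle.
  rewrite sumr_const_nat -[leRHS]mulr_natl natrB ?(ltnW (NS j))//.
  have [r0 rE] := rhoP j.
  have Nj2 : (N j.+1)%:R / 2 <= (N j.+1)%:R - (N j)%:R :> R.
    have : (2 * N j)%:R <= (N j.+1)%:R :> R by rewrite ler_nat ltnW.
    by rewrite natrM; lra.
  apply: le_trans (ler_wpM2l _ (ballvol_lower nuh r0 (rho1 j))); last first.
    by apply: le_trans Nj2; rewrite divr_ge0 ?ltW.
  have v0 : 0 <= (rho j / 2) ^+ d * mass nu.
    by rewrite mulr_ge0 ?exprn_ge0 ?divr_ge0// ltW.
  apply: le_trans (ler_wpM2r v0 Nj2).
  have -> : (N j.+1)%:R / 2 * ((rho j / 2) ^+ d * mass nu) =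
    ((N j.+1)%:R * rho j ^+ d) * ((2 ^+ d)^-1 * mass nu / 2).
    by rewrite expr_div_n; field; rewrite expf_neq0.
  by rewrite rE mul1r.
pose U (j : nat) : set TT := \bigcup_(n : 'I_(N j.+1)) ball (x0 - a *+ n) (rho j).
have mU j : measurable (U j : set (borel TT)).
  by apply: fin_bigcup_measurable => // *; exact: measurable_ball.
have U0 : nu (lim_sup_set U) = 0%E.
  apply: lim_sup_set_cvg0 => //.
  apply: le_lt_trans (ltry 1); apply: le_trans (epsilon_trick0 predT (@ler01 R)).
  apply: lee_nneseries => [//|j _].
  rewrite -[leLHS]fineK ?fin_num_measure// lee_fin.
  have [_ _ h] := fP (j, (2 * N j).+1); have [r0 rE] := rhoP j; exact: h.
apply/eqP; rewrite eq_le measure_ge0 andbT -U0; apply: le_measure; rewrite ?inE.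
- apply: bigcap_measurable => // j _; apply: bigcup_measurable => n _.
  exact: measurable_ball.
- by apply: bigcap_measurable => // j _; exact: bigcup_measurable.
move=> x Ex j _; have [n /= jn En] := Ex (N j) I.
exists (k n); first exact: kge.
by have /andP[_ nN] := kP n; exists (Ordinal nN).
Qed.

End well_approximable.

(** * Targets that every point hits finitely often *)

Section escaping_targets.
Context {R : realType} {d : nat}.
Local Notation TT := (torus R d).
Hypothesis d_gt0 : (0 < d)%N.
Variable nu : {finite_measure set (borel TT) -> \bar R}.
Hypothesis nuh : ball_homogeneous nu.
Hypothesis mass_gt0 : 0 < mass nu.
Variable a : TT.
Hypothesis a_free : forall n, (0 < n)%N -> a *+ n != 0.

Lemma orbit_recurrent_late (e : R) (M : nat) : 0 < e ->
  exists2 n, (M <= n)%N & tnorm (a *+ n) < e.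
Proof.
move=> e0; have eM : 0 < e / M.+1%:R by rewrite divr_gt0.
have [q q0 hq] := orbit_recurrent nuh mass_gt0 a eM.
exists (q * M.+1)%N; first by rewrite (leq_trans (leqnSn M))// leq_pmull.
rewrite mulrnA (le_lt_trans (tnormMn _ _))// mulrC.
by rewrite -ltr_pdivlMr.
Qed.

(** Adding to a short nonzero return [q a] the infinitely many returns that are
    less than half as long gives returns of size comparable to [q a]. *)
Lemma near_returns (e : R) : 0 < e -> exists2 c : R, 0 < c &
  forall M, exists2 n, (M <= n)%N & c <= tnorm (a *+ n) < e.
Proof.
move=> e0; have e2 : 0 < e / 2 by rewrite divr_gt0.
have [q q0 hq] := orbit_recurrent nuh mass_gt0 a e2.
have t0 : 0 < tnorm (a *+ q) by rewrite tnorm_gt0 a_free.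
have t2 : 0 < tnorm (a *+ q) / 2 by rewrite divr_gt0.
exists (tnorm (a *+ q) / 2) => // M.
have [j Mj hj] := orbit_recurrent_late M t2.
exists (q + j)%N; first by rewrite (leq_trans Mj)// leq_addl.
rewrite mulrnDr; apply/andP; split.
  have := tnormD (a *+ q + a *+ j) (- (a *+ j)); rewrite addrK tnormN; lra.
by apply: le_lt_trans (tnormD _ _) _; lra.
Qed.

Lemma returns_diverge (e b : R) (M : nat) : 0 < e -> exists N,
  b <= \sum_(M <= n < N | tnorm (a *+ n) < e) tnorm (a *+ n) ^+ d.
Proof.
move=> e0; have [c c0 hc] := near_returns e0.
have cd : 0 < c ^+ d by exact: exprn_gt0.
suff h p : exists2 N, (M <= N)%N &
    p%:R * c ^+ d <= \sum_(M <= n < N | tnorm (a *+ n) < e) tnorm (a *+ n) ^+ d.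
  have [b0|b0] := leP b 0; first by exists M; rewrite big_geq.
  have /andP[_] := truncn_itv (ltW (divr_gt0 b0 cd)).
  rewrite ltr_pdivrMr// => /ltW hb; set p := _.+1 in hb; have [N _ hN] := h p.
  by exists N; exact: le_trans hN.
elim: p => [|p [N MN IH]]; first by exists M => //; rewrite mul0r big_geq.
have [n Nn /andP[cn ne]] := hc N; have Mn := leq_trans MN Nn.
exists n.+1; first exact: leqW.
rewrite big_mkcond big_nat_recr//= -big_mkcond/= ne.
rewrite -natr1 mulrDl mul1r lerD//; last first.
  by rewrite lerXn2r// ?nnegrE ?tnorm_ge0// ltW.
apply: le_trans IH _; rewrite (big_cat_nat MN Nn)/= lerDl.
by apply: sumr_ge0 => i _; rewrite exprn_ge0 ?tnorm_ge0.
Qed.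

(** In the [j]-th block only the returns shorter than [1 / j.+1] are used, and
    the block is long enough for them to contribute a fixed amount to the
    series. *)
Lemma escaping_targets : exists r : R^nat,
  [/\ forall n, 0 <= r n <= 1,
      forall c, exists N, c <= \sum_(n < N) r n ^+ d &
      forall x0, lim_sup_set (fun n => ball (x0 - a *+ n) (r n)) = set0].
Proof.
pose e (j : nat) : R := j.+1%:R^-1.
have e0 j : 0 < e j by rewrite invr_gt0.
have /choice[f fP] : forall jM : nat * nat, exists N,
  1 <= \sum_(jM.2 <= n < N | tnorm (a *+ n) < e jM.1) tnorm (a *+ n) ^+ d.
  by move=> [j M]; exact: returns_diverge.
pose N := fix N k := if k is j.+1 then f (j, N j) else 0%N.
have NS j : (N j < N j.+1)%N.
  rewrite ltnNge; apply/negP => h.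
  by have := fP (j, N j); rewrite big_geq//= ler10.
have [k [kP kge kle]] := block_index (erefl : N 0%N = 0%N) NS.
pose r n := if tnorm (a *+ n) < e (k n) then tnorm (a *+ n) / 2 else 0.
(* radii are half the norm of the centre, so a point that is hit is neither 0
   nor far from 0 *)
have r_hit (y : TT) n : tnorm (y - a *+ n) < r n ->
    0 < tnorm y /\ tnorm y < 2 * e (k n).
  rewrite /r; case: ifP => [te|_]; last by rewrite ltNge tnorm_ge0.
  have := tnormD (y - a *+ n) (a *+ n); rewrite subrK.
  have := tnormD (a *+ n - y) y; rewrite subrK tnormB => h1 h2 h3.
  have := tnorm_ge0 (y - a *+ n); have := tnorm_ge0 (a *+ n).
  by split; lra.
exists r; split=> [n|c|x0].
- rewrite /r; case: ifP => _; last by rewrite lexx ler01.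
  rewrite divr_ge0 ?tnorm_ge0//=.
  by have := tnorm_le_half (a *+ n); have := tnorm_ge0 (a *+ n); lra.
- apply: (@series_blocks _ (fun n => r n ^+ d) N ((2 ^+ d)^-1) erefl) => [j||j].
  + exact: ltnW.
  + by rewrite invr_gt0 exprn_gt0.
  apply: (@le_trans _ _ (\sum_(N j <= n < N j.+1 | tnorm (a *+ n) < e j)
      tnorm (a *+ n) ^+ d / 2 ^+ d)).
    rewrite -mulr_suml -[leLHS]mul1r ler_wpM2r ?invr_ge0 ?exprn_ge0//.
    exact: (fP (j, N j)).
  rewrite big_mkcond; apply: ler_sum_nat => n /andP[n1 n2].
  have kn : k n = j by apply/eqP; rewrite eqn_leq kge// kle.
  by rewrite /r kn; case: ifP => _; rewrite ?expr_div_n// exprn_ge0.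
apply/seteqP; split=> // x Ex.
have hit M : exists2 n, (M <= n)%N & tnorm (x0 - x - a *+ n) < r n.
  have [n /= Mn] := Ex M I; rewrite ballE addrAC => h.
  by exists n.
have [n0 _ /r_hit[y0 _]] := hit 0%N.
have y2 : 0 < tnorm (x0 - x) / 2 by rewrite divr_gt0.
have [K] := ltr_add_invr y2; rewrite add0r => hK.
have [n Kn /r_hit[_ yn]] := hit (N K).
have : e (k n) <= e K by rewrite lef_pV2 ?posrE// ler_nat ltnS kge.
by move: yn hK; rewrite -/(e K); move: (e K) (e (k n)) => u v; lra.
Qed.

End escaping_targets.

(** * Shrinking target properties of toral translations *)

Section orbit_of_zero.
Context {R : realType} {d : nat}.
Local Notation TT := (torus R d).
Hypothesis d_gt0 : (0 < d)%N.

Lemma badly_free C (a : TT) : badly_approximable C a ->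
  forall n, (0 < n)%N -> a *+ n != 0.
Proof.
move=> [C0 h] n n0; rewrite -tnorm_gt0 lt_neqAle tnorm_ge0 andbT eq_sym.
apply/negP => /eqP t0; have := h n n0.
by rewrite t0 expr0n gtn_eqF// mulr0 leNgt C0.
Qed.

Lemma irrational_free (alpha : 'rV[R]_d) :
  ~ (forall i, exists q : rat, alpha 0 i = ratr q) ->
  forall n, (0 < n)%N -> toT alpha *+ n != 0 :> TT.
Proof.
move=> irr n n0; apply/negP => /eqP; rewrite -toTMn -toT0 => /toT_eq.
rewrite subr0 => /forallP int_n; apply: irr => i.
have /intrP[p] := int_n i; rewrite -scaler_nat mxE => pE.
exists (p%:~R / n%:R); rewrite rmorphM /= ratr_int fmorphV /= ratr_nat -pE.
by rewrite mulrAC mulfV ?mul1r// pnatr_eq0 -lt0n.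
Qed.

Lemma series_ballvol (nu : {finite_measure set (borel TT) -> \bar R}) (r : R^nat) :
  ball_homogeneous nu -> 0 < mass nu -> (forall n, 0 <= r n <= 1) ->
  (forall c, exists N, c <= \sum_(n < N) r n ^+ d) ->
  forall c, exists N, c <= \sum_(n < N) ballvol nu (r n).
Proof.
move=> nuh m0 r01 div c.
have k0 : 0 < mass nu / 2 ^+ d by rewrite divr_gt0// exprn_gt0.
have [N hN] := div (c / (mass nu / 2 ^+ d)); exists N.
apply: (@le_trans _ _ (\sum_(n < N) r n ^+ d * (mass nu / 2 ^+ d))).
  by rewrite -mulr_suml -ler_pdivrMr.
apply: ler_sum => n _; have /andP[] := r01 n.
rewrite le_eqVlt => /orP[/eqP <- _|r0 r1].
  by rewrite expr0n gtn_eqF// mul0r ballvol_ge0.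
by rewrite mulrCA mulrC -expr_div_n ballvol_lower.
Qed.

End orbit_of_zero.

Theorem theorem2p3 (R : realType) (d : nat) (d_gt0 : (0 < d)%N)
    (alpha : 'rV[R]_d) (mu : probability (borel (torus R d)) R)
    (mu_Haar : is_Haar mu) :
  [/\ MSTP mu (translation alpha) <-> constant_type alpha,
      ~ STP mu (translation alpha) &
      ~ (forall i, exists q : rat, alpha 0 i = ratr q) ->
      exists r : R^nat,
        [/\ forall n, 0 <= r n,
            (\sum_(n <oo) (r n ^+ d)%:E = +oo)%E &
            forall x0 : torus R d,
              lim_sup_set (fun n => iter n (translation alpha) @^-1`
                                      ball x0 (r n)) = set0]].
Proof.
pose a : torus R d := toT alpha.
case: (Haar_finite_measure mu_Haar) => m [mE mh m1].
have m0 : 0 < mass m by rewrite m1.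
have orbit_ball (x0 : torus R d) (r : R^nat) :
    (fun n => iter n (translation alpha) @^-1` ball x0 (r n)) =
    (fun n => ball (x0 - a *+ n) (r n)).
  by apply/funext => n; exact: preimage_translation_ball.
have divE (x0 : torus R d) (r : R^nat) :
    (forall c, exists N, c <= \sum_(n < N) ballvol m (r n)) ->
    (\sum_(n <oo) mu (ball x0 (r n)) = +oo)%E.
  by move=> /(series_ballP x0 r mh) <-; apply: eq_eseriesr => n _.
have not_BC (x0 : torus R d) (r : R^nat) :
    m (lim_sup_set (fun n => ball (x0 - a *+ n) (r n))) = 0%E ->
    ~ is_BC mu (translation alpha) (fun n => ball x0 (r n)).
  move=> h [_ _]; rewrite orbit_ball mE h => /(congr1 fine)/esym/eqP.
  by rewrite /= oner_eq0.
have MSTP_badly : MSTP mu (translation alpha) -> exists C, badly_approximable C a.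
  move=> H; apply: contrapT => no.
  have not_badly C : ~ badly_approximable C a by move=> bad; apply: no; exists C.
  have [r [rd rdiv r0]] := null_orbit_target d_gt0 mh m0 not_badly.
  exact: not_BC (r0 0) (H 0 r rd (divE 0 r rdiv)).
have escape (free : forall n, (0 < n)%N -> a *+ n != 0) :=
  escaping_targets mh m0 free.
split.
- rewrite (constant_typeP d_gt0); split=> [|[C bad]]; first exact: MSTP_badly.
  exact: badly_MSTP bad.
- move=> H.
  have [C bad] : exists C, badly_approximable C a.
    apply: MSTP_badly => x0 r rd div; apply: H => // n.
    by have /andP[] := rd n; exact: le_trans.
  have [r [r01 rdiv r0]] := escape (badly_free d_gt0 bad).
  have rge0 n : 0 <= r n by have /andP[] := r01 n.
  apply: (not_BC 0 r); first by rewrite r0 measure0.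
  apply: H => //; apply: divE; exact: series_ballvol.
- move=> /irrational_free/escape[r [r01 rdiv r0]]; exists r; split=> [n||x0].
  + by have /andP[] := r01 n.
  + apply/nneseries_pinftyP => // n; have /andP[rn _] := r01 n.
    exact: exprn_ge0.
  + by rewrite orbit_ball r0.
Qed.
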